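(* Let $\nu$ be a smooth complex valued function on $S^3$ with $|\nu|<1$, let $S^3_0$ be the standard CR 3-sphere, and let $S^3_1$ be $S^3$ with the CR structure whose $(0,1)$ tangent space is spanned by $\overline W_1=\overline W_0-\nu W_0$; assume that the CR structure on $S^3_1$ is $S^1$-invariant. Let $g_s:S^3_1\to S^3_0$ be a flow of contact transformations generated by a smooth vector field with contact Hamiltonian function $u$, and assume that $\mathrm{Im}(\overline\nu\,\overline W_0^2u)=0$ on the set where $\nu\neq0$. Then, on the set where $\nu\ne0$, for small $s\in\mathbb R$ the Beltrami tensor of $g_s$ satisfies $$|\mu_{g_s}|=|\nu|+\frac{1-|\nu|^2}{2|\nu|}\Big\{(1+|\nu|^2)\big|\overline W_0^2u\big|^2-(\overline\nu\,\overline W_0^2u)\Big[\Delta u+\mathrm{Re}\Big(\frac1\nu(\overline W_0\nu)(W_0u)-\frac1\nu(W_0\nu)(\overline W_0u)\Big)\Big]\Big\}s^2+\mathcal O(s^3),$$ where $\Delta u=(W_0\overline W_0+\overline W_0W_0)u$.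
   Context: $S^3=\{(w_1,w_2)\in\mathbb C^2: |w_1|^2+|w_2|^2=1\}$ with contact form $\eta=-\mathrm{Im}(w_1d\overline w_1+w_2d\overline w_2)$ and contact bundle $HS^3=\ker\eta$. The circle action is $U_\phi(w_1,w_2)=(e^{i\phi}w_1,e^{i\phi}w_2)$; a CR structure on $S^3$ is $S^1$-invariant if every $U_\phi$ is a CR map for it. $W_0=\overline w_2\frac{\partial}{\partial w_1}-\overline w_1\frac{\partial}{\partial w_2}$ and $\overline W_0$ span the $(1,0)$ and $(0,1)$ tangent spaces of $S^3_0$ (the CR structure inherited from $\mathbb C^2$); $\psi=w_2dw_1-w_1dw_2$, so $\langle\psi,W_0\rangle=1$, $\langle\psi,\overline W_0\rangle=0$. $W_1=W_0-\overline\nu\,\overline W_0$ is the conjugate of $\overline W_1$. The contact Hamiltonian function of a vector field $V$ generating a smooth flow of contact transformations (diffeomorphisms preserving $HS^3$) is the smooth real function $u=\langle\eta,V\rangle$. The flow satisfies $g_0=\mathrm{id}$. Beltrami tensor: for a $C^1$ contact mapping $f:S^3_1\to S^3_0$ preserving the orientation of $HS^3$, its Beltrami tensor $\mu_f$ is the section of $T^{1,0}S^3_1\otimes\wedge^{0,1}S^3_1$ such that $f_*\big(\overline W_1-\mu_f(\overline W_1)\big)\in T^{0,1}S^3_0$. Explicitly $\mu_f=\frac{\langle f^*\psi,\overline W_1\rangle}{\langle f^*\psi,W_1\rangle}W_1\otimes\overline\psi_1$, where $\overline\psi_1$ is the $(0,1)$ form on $S^3_1$ with $\langle\overline\psi_1,\overline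 W_1\rangle=1$, and $|\mu_f|=\left|\frac{\langle f^*\psi,\overline W_1\rangle}{\langle f^*\psi,W_1\rangle}\right|$. The asymptotics are as $s\to0$ at points of $S^3$. *)

(* Defs.v *)
From Stdlib Require Import Reals.
From Coquelicot Require Import Coquelicot.

Open Scope R_scope.

Definition dirD {E : NormedModule R_AbsRing} (f : E -> R) (v x : E) : R :=
  Derive (fun t : R => f (plus x (scal t v))) 0.

(* [U] is meant to be open. *)
Fixpoint Ck {E : NormedModule R_AbsRing} (n : nat) (U : E -> Prop)
    (f : E -> R) : Prop :=
  match n with
  | O => forall x, U x -> continuous f x
  | S m => (forall x, U x -> ex_filterdiff f (locally x)) /\
           (forall v, Ck m U (dirD f v))
  end.

Definition smooth {E : NormedModule R_AbsRing} (U : E -> Prop) (f : E -> R) :=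
  forall n, Ck n U f.

Definition smoothC {E : NormedModule R_AbsRing} (U : E -> Prop) (f : E -> C) :=
  smooth U (fun x => Re (f x)) /\ smooth U (fun x => Im (f x)).

Definition C2 : Type := (C * C)%type.

(* C^2 as a real normed space; the canonical structure on [C] is over [C]. *)
Definition C2R : NormedModule R_AbsRing :=
  prod_NormedModule R_AbsRing C_R_NormedModule C_R_NormedModule.

Definition smoothC2 {E : NormedModule R_AbsRing} (U : E -> Prop) (f : E -> C2) :=
  smoothC U (fun x => fst (f x)) /\ smoothC U (fun x => snd (f x)).

Definition S3 (w : C2) : Prop := Cmod (fst w) ^ 2 + Cmod (snd w) ^ 2 = 1.

Definition nonzero (w : C2) : Prop := w <> (RtoC 0, RtoC 0).

(* Functions on the sphere are represented by functions on C^2 of which only the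
   values on [S3] matter: they are always used through their extension constant
   along rays, [radial f].  A function on the sphere is smooth iff this extension
   is smooth off the origin, and its derivative along a vector tangent to the
   sphere is the derivative of any smooth extension. *)
Definition normalize (w : C2) : C2 :=
  let r := RtoC (sqrt (Cmod (fst w) ^ 2 + Cmod (snd w) ^ 2)) in
  (fst w / r, snd w / r)%C.

Definition radial {T : Type} (f : C2 -> T) (w : C2) : T := f (normalize w).

Definition smooth_fun_S3 (f : C2 -> C) : Prop :=
  smoothC (E := C2R) nonzero (radial f).

Definition smooth_map_S3 (f : C2 -> C2) : Prop :=
  smoothC2 (E := C2R) nonzero (radial f).

(* A real tangent vector of C^2 = R^4 is an element of C^2. *)
Definition tangent (w v : C2) : Prop :=
  Re (Cconj (fst w) * fst v + Cconj (snd w) * snd v)%C = 0.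

Definition eta (w v : C2) : R :=
  - Im (fst w * Cconj (fst v) + snd w * Cconj (snd v))%C.

Definition dirDC (F : C2 -> C) (v w : C2) : C :=
  (dirD (E := C2R) (fun x => Re (F x)) v w,
   dirD (E := C2R) (fun x => Im (F x)) v w).

Definition differential (f : C2 -> C2) (w v : C2) : C2 :=
  (dirDC (fun x => fst (radial f x)) v w,
   dirDC (fun x => snd (radial f x)) v w).

Definition maps_S3 (f : C2 -> C2) : Prop := forall w, S3 w -> S3 (f w).

Record contact_transformation (f : C2 -> C2) : Prop := {
  ct_maps : maps_S3 f;
  ct_smooth : smooth_map_S3 f;
  ct_diffeo : exists h, maps_S3 h /\ smooth_map_S3 h /\
    (forall w, S3 w -> h (f w) = w) /\ (forall w, S3 w -> f (h w) = w);
  ct_contact : forall w v, S3 w -> tangent w v ->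
    (eta w v = 0 <-> eta (f w) (differential f w v) = 0)
}.

Record smooth_vector_field (V : C2 -> C2) : Prop := {
  vf_smooth : smooth_map_S3 V;
  vf_tangent : forall w, S3 w -> tangent w (V w)
}.

Record contact_flow (V : C2 -> C2) (g : R -> C2 -> C2) : Prop := {
  cf_smooth :
    smoothC2 (E := prod_NormedModule R_AbsRing R_NormedModule C2R)
      (fun x => nonzero (snd x)) (fun x => radial (g (fst x)) (snd x));
  cf_id : forall w, S3 w -> g 0 w = w;
  cf_generated : forall s w, S3 w ->
    is_derive (K := R_AbsRing) (V := C2R) (fun t : R => g t w) s (V (g s w));
  cf_contact : forall s, contact_transformation (g s)
}.

Definition contact_hamiltonian (V : C2 -> C2) (u : C2 -> R) : Prop :=
  forall w, S3 w -> u w = eta w (V w).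

(* [CTVec (a1, a2) (b1, b2)] is
   a1 d/dw1 + a2 d/dw2 + b1 d/dwbar1 + b2 d/dwbar2. *)
Record ctvec : Type := CTVec { dw_part : C2; dwbar_part : C2 }.

Definition C2add (a b : C2) : C2 := (fst a + fst b, snd a + snd b)%C.
Definition C2scal (c : C) (a : C2) : C2 := (c * fst a, c * snd a)%C.

Definition ctadd (X Y : ctvec) : ctvec :=
  CTVec (C2add (dw_part X) (dw_part Y)) (C2add (dwbar_part X) (dwbar_part Y)).
Definition ctscal (c : C) (X : ctvec) : ctvec :=
  CTVec (C2scal c (dw_part X)) (C2scal c (dwbar_part X)).
Definition ctsub (X Y : ctvec) : ctvec := ctadd X (ctscal (- 1)%C Y).

Definition e1 : C2 := (RtoC 1, RtoC 0).
Definition e2 : C2 := (RtoC 0, RtoC 1).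

(* Wirtinger derivatives d/dw_j and d/dwbar_j, for [e] = [e1], [e2]. *)
Definition dw (e : C2) (F : C2 -> C) (w : C2) : C :=
  ((dirDC F e w - Ci * dirDC F (C2scal Ci e) w) / 2)%C.
Definition dwbar (e : C2) (F : C2 -> C) (w : C2) : C :=
  ((dirDC F e w + Ci * dirDC F (C2scal Ci e) w) / 2)%C.

Definition act (X : ctvec) (f : C2 -> C) (w : C2) : C :=
  (fst (dw_part X) * dw e1 (radial f) w
   + snd (dw_part X) * dw e2 (radial f) w
   + fst (dwbar_part X) * dwbar e1 (radial f) w
   + snd (dwbar_part X) * dwbar e2 (radial f) w)%C.

Definition lie (X : C2 -> ctvec) (f : C2 -> C) : C2 -> C :=
  fun w => act (X w) f w.

(* The complex-linear extension of [differential]. *)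
Definition pushforward (f : C2 -> C2) (w : C2) (X : ctvec) : ctvec :=
  CTVec (act X (fun x => fst (f x)) w, act X (fun x => snd (f x)) w)
        (act X (fun x => Cconj (fst (f x))) w,
         act X (fun x => Cconj (snd (f x))) w).

Definition W0 (w : C2) : ctvec :=
  CTVec (Cconj (snd w), - Cconj (fst w))%C (RtoC 0, RtoC 0).
Definition W0bar (w : C2) : ctvec :=
  CTVec (RtoC 0, RtoC 0) (snd w, - fst w)%C.

Definition W1 (nu : C2 -> C) (w : C2) : ctvec :=
  ctsub (W0 w) (ctscal (Cconj (nu w)) (W0bar w)).
Definition W1bar (nu : C2 -> C) (w : C2) : ctvec :=
  ctsub (W0bar w) (ctscal (nu w) (W0 w)).

(* The (0,1) tangent space at [w] of the CR structure defined by [nu]; the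
   standard structure is the case [nu] = 0. *)
Definition T01 (nu : C2 -> C) (w : C2) (X : ctvec) : Prop :=
  exists c : C, X = ctscal c (W1bar nu w).
Definition nu_std : C2 -> C := fun _ => RtoC 0.

Definition CR_map (nu nu' : C2 -> C) (f : C2 -> C2) : Prop :=
  forall w X, S3 w -> T01 nu w X -> T01 nu' (f w) (pushforward f w X).

Definition rot (phi : R) (w : C2) : C2 := C2scal (cos phi, sin phi) w.

Definition S1_invariant (nu : C2 -> C) : Prop :=
  forall phi, CR_map nu nu (rot phi).

(* [m] is the coefficient of the Beltrami tensor of [f] in the frame
   W_1 (x) psibar_1, that is mu_f (W1bar) = m W_1; hence |mu_f| = |m|. *)
Definition is_beltrami (nu : C2 -> C) (f : C2 -> C2) (m : C2 -> C) : Prop :=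
  forall w, S3 w ->
    T01 nu_std (f w)
      (pushforward f w (ctsub (W1bar nu w) (ctscal (m w) (W1 nu w)))).

Definition Laplacian (u : C2 -> C) (w : C2) : C :=
  (lie W0 (lie W0bar u) w + lie W0bar (lie W0 u) w)%C.

(* Main.v *)
Require Import Defs.
From Stdlib Require Import Reals Lra Lia Psatz.
From Coquelicot Require Import Coquelicot.

(* Write Z = W_0.  The field is
   V = u T + i (Zbar u) Z - i (Z u) Zbar with T the generator of the circle action,
   and g_s^* psi = A theta + B thetabar on the contact planes, where theta, thetabar
   is dual to Z, Zbar.  Differentiating along the flow gives
     A' = a A + b Bbar,   B' = a B + b Abar,   A(0) = 1, B(0) = 0,
   where a = 2iu + i Z Zbar u and b = i Zbar^2 u are taken at g_s(w).  Since
   mu = (B - nu A) / (A - nubar B),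
     (|mu|^2 - |nu|^2) |A - nubar B|^2
       = (1 - |nu|^2) ((1 + |nu|^2) |B|^2 - 2 Re (nubar B Abar)),
   and only the second-order expansion of B Abar is needed.  Its first-order term
   is removed by Im (nubar Zbar^2 u) = 0; in its second-order term Im (nubar V Zbar^2 u)
   is computed by differentiating the same identity along V, using T nu = 4 i nu. *)

(** [g s] maps contact vectors to contact vectors, so on the contact planes its differential is one
    complex function: the pairing of psi with the image of c Z + cbar Zbar. Its evolution equation
    is only real-linear, and separating c from cbar couples A to Bbar and B to Abar. Half of the 2iu
    in a comes from differentiating the rotation part u T of V, the other half from differentiating
    the coefficients of psi along the flow. The weight 4 of nu arises because rotation by phi
    multiplies Z by e^{2i phi} and Zbar by e^{-2i phi}. It is matched to a: in the second-order
    coefficient the undifferentiated u enters as 4u through a + 3 abar and as -4u through T nu, so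
    that only derivatives of u survive. mu is given only by mu (A - nubar B) = B - nu A, without
    regularity in s. The expansion is therefore proved for squared moduli and transferred to M =
    |mu| by dividing M^2 - q^2 by M + q, where q = |nu| + k s^2 stays away from 0 since nu does not
    vanish. A and B are expanded by integrating their equations repeatedly, from a up to O(s) and b
    up to O(s^2). *)

Open Scope R_scope.

(* The Reals library declares constants with these names. *)
Notation nonzero := Defs.nonzero.
Notation differential := Defs.differential.

(** * Directional derivatives and functions of class C^k *)

Section DirectionalCalculus.

Context {E : NormedModule R_AbsRing}.

Lemma filterdiff_is_derive_line (f : E -> R) (l : E -> R) (v x : E) (t : R) :
  filterdiff f (locally (plus x (scal t v))) l ->
  is_derive (fun r : R => f (plus x (scal r v))) t (l v).
Proof.
  intros Hf.
  assert (Hc : filterdiff (fun r : R => plus x (scal r v)) (locally t)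
                 (fun r : R => plus zero (scal r v))).
  { apply (filterdiff_plus_fct (fun _ : R => x) (fun r : R => scal r v)).
    - refine (filterdiff_const x).
    - apply (filterdiff_scal_l v). }
  pose proof (filterdiff_comp' _ f t _ l Hc Hf) as H.
  refine (filterdiff_ext_lin _ _ _ H _).
  intros y. rewrite plus_zero_l. destruct Hf as [Hl _].
  apply (linear_scal _ Hl).
Qed.

Lemma line_at_0 (v x : E) : plus x (scal 0 v) = x.
Proof. rewrite <- (plus_zero_r x) at 2. f_equal. apply (scal_zero_l v). Qed.

Lemma filterdiff_dirD_eq (f l : E -> R) (v x : E) :
  filterdiff f (locally x) l -> dirD f v x = l v.
Proof.
  intros Hf. apply is_derive_unique, filterdiff_is_derive_line.
  now rewrite line_at_0.
Qed.

(** [dirD] is a total function with no linearity of its own. Where a Frechet differential exists it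
    coincides with it, and linearity in the direction is read off from there. *)
Lemma filterdiff_dirD (f : E -> R) (x : E) :
  ex_filterdiff f (locally x) -> filterdiff f (locally x) (fun v => dirD f v x).
Proof.
  intros [l Hl]. apply filterdiff_ext_lin with l; [exact Hl|].
  intros v. symmetry. now apply filterdiff_dirD_eq.
Qed.

Lemma is_derive_line (f : E -> R) (v x : E) (t : R) :
  ex_filterdiff f (locally (plus x (scal t v))) ->
  is_derive (fun r : R => f (plus x (scal r v))) t (dirD f v (plus x (scal t v))).
Proof.
  intros Hf.
  exact (filterdiff_is_derive_line f _ v x t (filterdiff_dirD f _ Hf)).
Qed.

Lemma dirD_plus_dir (f : E -> R) (v w x : E) :
  ex_filterdiff f (locally x) -> dirD f (plus v w) x = dirD f v x + dirD f w x.
Proof.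
  intros Hf. destruct (filterdiff_dirD f x Hf) as [Hl _].
  apply (linear_plus _ Hl).
Qed.

Lemma dirD_scal_dir (f : E -> R) (k : R) (v x : E) :
  ex_filterdiff f (locally x) -> dirD f (scal k v) x = k * dirD f v x.
Proof.
  intros Hf. destruct (filterdiff_dirD f x Hf) as [Hl _].
  apply (linear_scal _ Hl).
Qed.

Lemma is_derive_curve (f : E -> R) (c : R -> E) (c' : E) (t : R) :
  is_derive (K := R_AbsRing) c t c' -> ex_filterdiff f (locally (c t)) ->
  is_derive (fun r => f (c r)) t (dirD f c' (c t)).
Proof.
  intros Hc Hf.
  pose proof (filterdiff_dirD _ _ Hf) as Hl.
  pose proof (filterdiff_comp' _ f t _ _ Hc Hl) as H.
  refine (filterdiff_ext_lin _ _ _ H _).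
  intros y. now rewrite dirD_scal_dir.
Qed.

Lemma locally_line (P : E -> Prop) (v x : E) (t : R) :
  locally (plus x (scal t v)) P -> locally t (fun r : R => P (plus x (scal r v))).
Proof.
  intros HP.
  assert (Hc : continuous (fun r : R => plus x (scal r v)) t).
  { refine (filterdiff_continuous (K := R_AbsRing) _ _ _).
    refine (ex_filterdiff_plus_fct (fun _ : R => x) (fun r : R => scal r v) _ _).
    - refine (ex_filterdiff_const x).
    - eexists. exact (filterdiff_scal_l v). }
  exact (Hc _ HP).
Qed.

Lemma dirD_ext_loc (f g : E -> R) (v x : E) :
  locally x (fun y => f y = g y) -> dirD f v x = dirD g v x.
Proof.
  intros H. refine (Derive_ext_loc _ _ 0 (locally_line (fun y => f y = g y) v x 0 _)).
  now rewrite line_at_0.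
Qed.

Lemma ex_filterdiff_ext_loc (f g : E -> R) (x : E) :
  locally x (fun y => f y = g y) ->
  ex_filterdiff f (locally x) -> ex_filterdiff g (locally x).
Proof.
  intros Hfg [l Hl]. exists l.
  apply (filterdiff_ext_locally f g x l); assumption.
Qed.

Variable U : E -> Prop.
Hypothesis U_open : open U.

(** Openness of [U] is essential: derivatives at a point depend on nearby values, and these must lie
    in the set where [f] and [g] agree. *)
Lemma Ck_ext (n : nat) : forall f g : E -> R,
  (forall x, U x -> f x = g x) -> Ck n U f -> Ck n U g.
Proof.
  induction n as [|n IH]; intros f g Hfg.
  - intros Hf x Hx. apply (continuous_ext_loc _ f); [|now apply Hf].
    apply filter_imp with U; [|now apply U_open].
    intros y Hy. now apply Hfg.
  - intros [Hf Hd].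
    assert (HL : forall x, U x -> locally x (fun y => f y = g y)).
    { intros x Hx. apply filter_imp with U; [|now apply U_open].
      intros y Hy. now apply Hfg. }
    split.
    + intros x Hx. apply ex_filterdiff_ext_loc with f; auto.
    + intros v. apply IH with (dirD f v); [|apply Hd].
      intros x Hx. apply dirD_ext_loc; auto.
Qed.

(** Serves the product rule, where the derivative of [f * g] contains the undifferentiated factors
    and these are needed one class lower. *)
Lemma Ck_le_S (n : nat) : forall f : E -> R, Ck (S n) U f -> Ck n U f.
Proof.
  induction n as [|n IH]; intros f [Hf Hd].
  - intros x Hx. exact (filterdiff_continuous (K := R_AbsRing) (V := R_NormedModule) f x (Hf x Hx)).
  - split; [exact Hf|]. intros v. apply IH, Hd.
Qed.

Lemma Ck_const (n : nat) : forall c : R, Ck n U (fun _ => c).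
Proof.
  induction n as [|n IH]; intros c.
  - intros x _. apply continuous_const.
  - split.
    + intros x _. refine (ex_filterdiff_const c).
    + intros v. apply Ck_ext with (fun _ => 0); [|apply IH].
      intros x _. unfold dirD. now rewrite Derive_const.
Qed.

Lemma Ck_linear (n : nat) (l : E -> R) : is_linear l -> Ck n U l.
Proof.
  intros Hl. destruct n as [|n].
  - intros x _. exact (linear_cont (K := R_AbsRing) (V := R_NormedModule) l x Hl).
  - split.
    + intros x _. exact (ex_filterdiff_linear l Hl).
    + intros v. apply Ck_ext with (fun _ => l v); [|apply Ck_const].
      intros x _. symmetry. apply filterdiff_dirD_eq. exact (filterdiff_linear l Hl).
Qed.

Lemma dirD_plus (f g : E -> R) (v x : E) :
  ex_filterdiff f (locally x) -> ex_filterdiff g (locally x) ->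
  dirD (fun y => f y + g y) v x = dirD f v x + dirD g v x.
Proof.
  intros Hf Hg.
  apply (filterdiff_dirD_eq _ (fun v => dirD f v x + dirD g v x)).
  exact (filterdiff_plus_fct f g _ _ (filterdiff_dirD f x Hf) (filterdiff_dirD g x Hg)).
Qed.

Lemma dirD_mult (f g : E -> R) (v x : E) :
  ex_filterdiff f (locally x) -> ex_filterdiff g (locally x) ->
  dirD (fun y => f y * g y) v x = dirD f v x * g x + f x * dirD g v x.
Proof.
  intros Hf Hg.
  apply (filterdiff_dirD_eq _ (fun v => dirD f v x * g x + f x * dirD g v x)).
  exact (filterdiff_mult_fct (K := R_AbsRing) f g x _ _ Rmult_comm
           (filterdiff_dirD f x Hf) (filterdiff_dirD g x Hg)).
Qed.

Lemma ex_filterdiff_Rmult (f g : E -> R) (x : E) :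
  ex_filterdiff f (locally x) -> ex_filterdiff g (locally x) ->
  ex_filterdiff (fun y => f y * g y) (locally x).
Proof.
  intros Hf Hg. eexists.
  exact (filterdiff_mult_fct (K := R_AbsRing) f g x _ _ Rmult_comm
           (filterdiff_dirD f x Hf) (filterdiff_dirD g x Hg)).
Qed.

Lemma ex_filterdiff_Rplus (f g : E -> R) (x : E) :
  ex_filterdiff f (locally x) -> ex_filterdiff g (locally x) ->
  ex_filterdiff (fun y => f y + g y) (locally x).
Proof. intros Hf Hg. exact (ex_filterdiff_plus_fct f g Hf Hg). Qed.

Lemma Ck_plus (n : nat) : forall f g : E -> R,
  Ck n U f -> Ck n U g -> Ck n U (fun x => f x + g x).
Proof.
  induction n as [|n IH]; intros f g.
  - intros Hf Hg x Hx. apply (continuous_plus f g); auto.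
  - intros [Hf Df] [Hg Dg]. split.
    + intros x Hx. apply ex_filterdiff_Rplus; auto.
    + intros v. apply Ck_ext with (fun x => dirD f v x + dirD g v x).
      * intros x Hx. symmetry. apply dirD_plus; auto.
      * apply IH; [apply Df|apply Dg].
Qed.

Lemma Ck_mult (n : nat) : forall f g : E -> R,
  Ck n U f -> Ck n U g -> Ck n U (fun x => f x * g x).
Proof.
  induction n as [|n IH]; intros f g.
  - intros Hf Hg x Hx. apply (continuous_mult f g); auto.
  - intros Cf Cg. pose proof (Ck_le_S n f Cf) as Cf'.
    pose proof (Ck_le_S n g Cg) as Cg'.
    destruct Cf as [Hf Df], Cg as [Hg Dg]. split.
    + intros x Hx. apply ex_filterdiff_Rmult; auto.
    + intros v. apply Ck_ext with (fun x => dirD f v x * g x + f x * dirD g v x).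
      * intros x Hx. symmetry. apply dirD_mult; auto.
      * apply Ck_plus; apply IH; auto.
Qed.

Lemma smooth_ext (f g : E -> R) :
  (forall x, U x -> f x = g x) -> smooth U f -> smooth U g.
Proof. intros H Hf n. now apply Ck_ext with f. Qed.

Lemma smooth_const (c : R) : smooth U (fun _ => c).
Proof. intros n. apply Ck_const. Qed.

Lemma smooth_linear (l : E -> R) : is_linear l -> smooth U l.
Proof. intros H n. now apply Ck_linear. Qed.

Lemma smooth_plus (f g : E -> R) :
  smooth U f -> smooth U g -> smooth U (fun x => f x + g x).
Proof. intros Hf Hg n. now apply Ck_plus. Qed.

Lemma smooth_mult (f g : E -> R) :
  smooth U f -> smooth U g -> smooth U (fun x => f x * g x).
Proof. intros Hf Hg n. now apply Ck_mult. Qed.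

Lemma smooth_opp (f : E -> R) : smooth U f -> smooth U (fun x => - f x).
Proof.
  intros Hf. apply smooth_ext with (fun x => (-1) * f x).
  - intros x _. ring.
  - apply smooth_mult; [apply smooth_const|exact Hf].
Qed.

Lemma smooth_minus (f g : E -> R) :
  smooth U f -> smooth U g -> smooth U (fun x => f x - g x).
Proof. intros Hf Hg. apply smooth_plus; [|apply smooth_opp]; assumption. Qed.

Lemma smooth_dirD (f : E -> R) (v : E) : smooth U f -> smooth U (dirD f v).
Proof. intros Hf n. apply (Hf (S n)). Qed.

Lemma smooth_ex_filterdiff (f : E -> R) (x : E) :
  smooth U f -> U x -> ex_filterdiff f (locally x).
Proof. intros Hf Hx. now apply (Hf 1%nat). Qed.

Lemma continuous_plane (v w x : E) (a b : R) :
  continuous (fun z : R * R => plus x (plus (scal (fst z) v) (scal (snd z) w))) (a, b).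
Proof.
  refine (filterdiff_continuous (K := R_AbsRing) (U := prod_NormedModule R_AbsRing R_NormedModule R_NormedModule) _ _ _).
  refine (ex_filterdiff_plus_fct (fun _ => x)
    (fun z : R * R => plus (scal (fst z) v) (scal (snd z) w)) _ _);
    [refine (ex_filterdiff_const x) |].
  refine (ex_filterdiff_plus_fct (fun z : R * R => scal (fst z) v)
    (fun z : R * R => scal (snd z) w) _ _).
  - eexists. apply (filterdiff_scal_l_fct v (fun z : R * R => fst z)).
    apply filterdiff_linear, is_linear_fst.
  - eexists. apply (filterdiff_scal_l_fct w (fun z : R * R => snd z)).
    apply filterdiff_linear, is_linear_snd.
Qed.

(** Restriction to the plane x + a v + b w reduces the claim to the Schwarz theorem for two real
    variables. Reading [P a b] as a point on a line along [v] ([Pv]) or along [w] ([Pw]) turns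
    partial derivatives into [dirD]. *)
Lemma dirD_comm (f : E -> R) (v w x : E) :
  smooth U f -> U x -> dirD (dirD f v) w x = dirD (dirD f w) v x.
Proof.
  intros Hf Hx.
  set (P := fun a b : R => plus x (plus (scal a v) (scal b w))).
  set (F := fun a b : R => f (P a b)).
  assert (P0 : P 0 0 = x).
  { unfold P. rewrite <- (plus_zero_r x) at 2. f_equal.
    rewrite <- (plus_zero_r zero). f_equal; [exact (scal_zero_l v)|exact (scal_zero_l w)]. }
  assert (PU : locally_2d (fun a b => U (P a b)) 0 0).
  { apply locally_2d_locally. refine (continuous_plane v w x 0 0 U _).
    change (locally (P 0 0) U). rewrite P0. now apply U_open. }
  assert (Pv : forall a b, P a b = plus (plus x (scal b w)) (scal a v)).
  { intros a b. unfold P. rewrite <- plus_assoc. f_equal. apply plus_comm. }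
  assert (Pw : forall a b, P a b = plus (plus x (scal a v)) (scal b w)).
  { intros a b. unfold P. apply plus_assoc. }
  assert (Dv : forall h a b, smooth U h -> U (P a b) ->
            is_derive (fun t => h (P t b)) a (dirD h v (P a b))).
  { intros h a b Hh HU. rewrite Pv.
    apply is_derive_ext with (fun t => h (plus (plus x (scal b w)) (scal t v))).
    - intros t. now rewrite Pv.
    - apply is_derive_line. rewrite <- Pv. now apply smooth_ex_filterdiff. }
  assert (Dw : forall h a b, smooth U h -> U (P a b) ->
            is_derive (fun t => h (P a t)) b (dirD h w (P a b))).
  { intros h a b Hh HU. rewrite Pw.
    apply is_derive_ext with (fun t => h (plus (plus x (scal a v)) (scal t w))).
    - intros t. now rewrite Pw.
    - apply is_derive_line. rewrite <- Pw. now apply smooth_ex_filterdiff. }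
  assert (Uv : forall a b, U (P a b) -> locally a (fun t => U (P t b))).
  { intros a b HU. apply U_open in HU. rewrite Pv in HU.
    apply filter_imp with (2 := locally_line _ _ _ _ HU).
    intros t. now rewrite Pv. }
  assert (Uw : forall a b, U (P a b) -> locally b (fun t => U (P a t))).
  { intros a b HU. apply U_open in HU. rewrite Pw in HU.
    apply filter_imp with (2 := locally_line _ _ _ _ HU).
    intros t. now rewrite Pw. }
  assert (Dvw : forall a b, U (P a b) ->
     is_derive (fun z => Derive (fun t => F z t) b) a (dirD (dirD f w) v (P a b))).
  { intros a b HU. apply is_derive_ext_loc with (fun z => dirD f w (P z b)).
    - apply filter_imp with (2 := Uv a b HU). intros z Hz.
      symmetry. now apply is_derive_unique, Dw.
    - apply Dv; [now apply smooth_dirD|exact HU]. }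
  assert (Dwv : forall a b, U (P a b) ->
     is_derive (fun z => Derive (fun t => F t z) a) b (dirD (dirD f v) w (P a b))).
  { intros a b HU. apply is_derive_ext_loc with (fun z => dirD f v (P a z)).
    - apply filter_imp with (2 := Uw a b HU). intros z Hz.
      symmetry. now apply is_derive_unique, Dv.
    - apply Dw; [now apply smooth_dirD|exact HU]. }
  assert (Hcont : forall h : E -> R, smooth U h ->
     continuity_2d_pt (fun a b => h (P a b)) 0 0).
  { intros h Hh. apply continuity_2d_pt_filterlim.
    apply (continuous_comp (fun z : R * R => P (fst z) (snd z)) h (0, 0)).
    - apply (continuous_plane v w x 0 0).
    - simpl. rewrite P0. now apply (Hh 0%nat). }
  assert (HS : Derive (fun z => Derive (fun t => F z t) 0) 0
             = Derive (fun z => Derive (fun t => F t z) 0) 0).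
  { apply Schwarz.
    - apply locally_2d_impl with (2 := PU). apply locally_2d_forall.
      intros a b HU. repeat split; eexists.
      + now apply (Dv f).
      + now apply (Dw f).
      + now apply Dvw.
      + now apply Dwv.
    - apply continuity_2d_pt_ext_loc with (fun a b => dirD (dirD f w) v (P a b)).
      + apply locally_2d_impl with (2 := PU). apply locally_2d_forall.
        intros a b HU. symmetry. now apply is_derive_unique, Dvw.
      + now apply Hcont, smooth_dirD, smooth_dirD.
    - apply continuity_2d_pt_ext_loc with (fun a b => dirD (dirD f v) w (P a b)).
      + apply locally_2d_impl with (2 := PU). apply locally_2d_forall.
        intros a b HU. symmetry. now apply is_derive_unique, Dwv.
      + now apply Hcont, smooth_dirD, smooth_dirD. }
  assert (U00 : U (P 0 0)) by now rewrite P0.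
  rewrite <- P0.
  etransitivity; [symmetry; exact (is_derive_unique _ _ _ (Dwv 0 0 U00))|].
  etransitivity; [symmetry; exact HS|].
  exact (is_derive_unique _ _ _ (Dvw 0 0 U00)).
Qed.

End DirectionalCalculus.

Lemma C_ext (a b : C) : Re a = Re b -> Im a = Im b -> a = b.
Proof. apply injective_projections. Qed.

Lemma Cmod_sqr (z : C) : Cmod z ^ 2 = Re z ^ 2 + Im z ^ 2.
Proof.
  unfold Cmod. rewrite <- Rsqr_pow2, Rsqr_sqrt; [reflexivity|].
  apply Rplus_le_le_0_compat; apply pow2_ge_0.
Qed.

(** * Complex-valued smooth functions *)

Definition diffC {E : NormedModule R_AbsRing} (F : E -> C) (p : E) : Prop :=
  ex_filterdiff (fun x => Re (F x)) (locally p) /\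
  ex_filterdiff (fun x => Im (F x)) (locally p).

Definition is_deriveC (f : R -> C) (t : R) (l : C) : Prop :=
  is_derive (fun r => Re (f r)) t (Re l) /\ is_derive (fun r => Im (f r)) t (Im l).

Section SmoothC.

Context {E : NormedModule R_AbsRing}.
Variable U : E -> Prop.
Hypothesis U_open : open U.

Lemma smoothC_ext (f g : E -> C) :
  (forall x, U x -> f x = g x) -> smoothC U f -> smoothC U g.
Proof.
  intros H [Hr Hi]. split.
  - apply (smooth_ext U U_open (fun x => Re (f x))); [|exact Hr].
    intros x Hx. now rewrite H.
  - apply (smooth_ext U U_open (fun x => Im (f x))); [|exact Hi].
    intros x Hx. now rewrite H.
Qed.

Lemma smoothC_const (c : C) : smoothC U (fun _ => c).
Proof. split; now apply smooth_const. Qed.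

Lemma smoothC_plus (f g : E -> C) :
  smoothC U f -> smoothC U g -> smoothC U (fun x => f x + g x)%C.
Proof.
  intros [Hr Hi] [Gr Gi]. split.
  - now apply (smooth_plus U U_open (fun x => Re (f x)) (fun x => Re (g x))).
  - now apply (smooth_plus U U_open (fun x => Im (f x)) (fun x => Im (g x))).
Qed.

Lemma smoothC_opp (f : E -> C) : smoothC U f -> smoothC U (fun x => - f x)%C.
Proof.
  intros [Hr Hi]. split.
  - now apply (smooth_opp U U_open (fun x => Re (f x))).
  - now apply (smooth_opp U U_open (fun x => Im (f x))).
Qed.

Lemma smoothC_minus (f g : E -> C) :
  smoothC U f -> smoothC U g -> smoothC U (fun x => f x - g x)%C.
Proof.
  intros Hf Hg. apply (smoothC_plus f (fun x => - g x)%C); [exact Hf|].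
  now apply smoothC_opp.
Qed.

Lemma smoothC_mult (f g : E -> C) :
  smoothC U f -> smoothC U g -> smoothC U (fun x => f x * g x)%C.
Proof.
  intros [Hr Hi] [Gr Gi]. split.
  - apply (smooth_minus U U_open (fun x => Re (f x) * Re (g x))
             (fun x => Im (f x) * Im (g x))); now apply smooth_mult.
  - apply (smooth_plus U U_open (fun x => Re (f x) * Im (g x))
             (fun x => Im (f x) * Re (g x))); now apply smooth_mult.
Qed.

Lemma smoothC_conj (f : E -> C) : smoothC U f -> smoothC U (fun x => Cconj (f x)).
Proof.
  intros [Hr Hi]. split; [exact Hr|].
  now apply (smooth_opp U U_open (fun x => Im (f x))).
Qed.

Lemma smoothC_RtoC (f : E -> R) : smooth U f -> smoothC U (fun x => RtoC (f x)).
Proof. intros Hf. split; [exact Hf|]. now apply (smooth_const U U_open 0). Qed.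

Lemma smoothC_diffC (f : E -> C) (x : E) : smoothC U f -> U x -> diffC f x.
Proof. intros [Hr Hi] Hx. split; now apply (smooth_ex_filterdiff U). Qed.

End SmoothC.

Lemma dirDC_ext_loc (F G : C2 -> C) (v p : C2) :
  locally (T := C2R) p (fun x => F x = G x) -> dirDC F v p = dirDC G v p.
Proof.
  intros H. apply C_ext; apply (dirD_ext_loc (E := C2R));
    apply filter_imp with (2 := H); intros x Hx; now rewrite Hx.
Qed.

Lemma dirDC_plus_dir (F : C2 -> C) (v w p : C2) :
  diffC (E := C2R) F p ->
  dirDC F (plus (G := C2R) v w) p = (dirDC F v p + dirDC F w p)%C.
Proof. intros [Hr Hi]. apply C_ext; now apply (dirD_plus_dir (E := C2R)). Qed.

Lemma dirDC_scal_dir (F : C2 -> C) (k : R) (v p : C2) :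
  diffC (E := C2R) F p ->
  dirDC F (scal (V := C2R) k v) p = (RtoC k * dirDC F v p)%C.
Proof.
  intros [Hr Hi]. apply C_ext.
  - etransitivity; [exact (dirD_scal_dir (E := C2R) (fun x => Re (F x)) k v p Hr)|].
    change (k * Re (dirDC F v p) = k * Re (dirDC F v p) - 0 * Im (dirDC F v p)). ring.
  - etransitivity; [exact (dirD_scal_dir (E := C2R) (fun x => Im (F x)) k v p Hi)|].
    change (k * Im (dirDC F v p) = k * Im (dirDC F v p) + 0 * Re (dirDC F v p)). ring.
Qed.

Lemma dirDC_mult (F G : C2 -> C) (v p : C2) :
  diffC (E := C2R) F p -> diffC (E := C2R) G p ->
  dirDC (fun x => F x * G x)%C v p = (dirDC F v p * G p + F p * dirDC G v p)%C.
Proof.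
  intros [Fr Fi] [Gr Gi].
  pose proof (dirD_mult (E := C2R) _ _ v p Fr Gr) as Hrr.
  pose proof (dirD_mult (E := C2R) _ _ v p Fi Gi) as Hii.
  pose proof (dirD_mult (E := C2R) _ _ v p Fr Gi) as Hri.
  pose proof (dirD_mult (E := C2R) _ _ v p Fi Gr) as Hir.
  pose proof (ex_filterdiff_Rmult (E := C2R) _ _ p Fr Gr) as Drr.
  pose proof (ex_filterdiff_Rmult (E := C2R) _ _ p Fi Gi) as Dii.
  pose proof (ex_filterdiff_Rmult (E := C2R) _ _ p Fr Gi) as Dri.
  pose proof (ex_filterdiff_Rmult (E := C2R) _ _ p Fi Gr) as Dir.
  apply C_ext.
  - change (dirD (E := C2R) (fun x => Re (F x) * Re (G x) - Im (F x) * Im (G x)) v p =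
      (Re (dirDC F v p) * Re (G p) - Im (dirDC F v p) * Im (G p)) +
      (Re (F p) * Re (dirDC G v p) - Im (F p) * Im (dirDC G v p))).
    transitivity (dirD (E := C2R)
      (fun x => Re (F x) * Re (G x) + (-1) * (Im (F x) * Im (G x))) v p).
    { apply (dirD_ext_loc (E := C2R)), filter_forall. intros x. ring. }
    rewrite (dirD_plus (E := C2R)); [|exact Drr|
      exact (ex_filterdiff_Rmult (E := C2R) _ _ p (ex_filterdiff_const (-1)) Dii)].
    rewrite (dirD_mult (E := C2R) (fun _ => -1) (fun x => Im (F x) * Im (G x)));
      [|exact (ex_filterdiff_const (-1))|exact Dii].
    rewrite Hrr, Hii. unfold dirD at 3. rewrite Derive_const. simpl. ring.
  - change (dirD (E := C2R) (fun x => Re (F x) * Im (G x) + Im (F x) * Re (G x)) v p =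
      (Re (dirDC F v p) * Im (G p) + Im (dirDC F v p) * Re (G p)) +
      (Re (F p) * Im (dirDC G v p) + Im (F p) * Re (dirDC G v p))).
    rewrite (dirD_plus (E := C2R)) by assumption.
    rewrite Hri, Hir. simpl. ring.
Qed.

Lemma dirDC_plus (F G : C2 -> C) (v p : C2) :
  diffC (E := C2R) F p -> diffC (E := C2R) G p ->
  dirDC (fun x => F x + G x)%C v p = (dirDC F v p + dirDC G v p)%C.
Proof.
  intros [Fr Fi] [Gr Gi]. apply C_ext.
  - now apply (dirD_plus (E := C2R) (fun x => Re (F x)) (fun x => Re (G x))).
  - now apply (dirD_plus (E := C2R) (fun x => Im (F x)) (fun x => Im (G x))).
Qed.

Lemma dirDC_const (c : C) (v p : C2) : dirDC (fun _ => c) v p = RtoC 0.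
Proof. apply C_ext; [exact (Derive_const (Re c) 0)|exact (Derive_const (Im c) 0)]. Qed.

Lemma dirDC_conj (F : C2 -> C) (v p : C2) :
  dirDC (fun x => Cconj (F x)) v p = Cconj (dirDC F v p).
Proof. apply C_ext; [reflexivity|].
  exact (Derive_opp (fun t : R => Im (F (plus (G := C2R) p (scal t v)))) 0). Qed.

(** * Curves in C^2 and complex-valued functions of a real variable *)

Lemma filterdiff_pair {E F1 F2 : NormedModule R_AbsRing}
    (f : E -> F1) (g : E -> F2) (x : E) (lf : E -> F1) (lg : E -> F2) :
  filterdiff f (locally x) lf -> filterdiff g (locally x) lg ->
  filterdiff (V := prod_NormedModule R_AbsRing F1 F2)
    (fun y => (f y, g y)) (locally x) (fun y => (lf y, lg y)).
Proof.
  intros Hf Hg.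
  refine (filterdiff_comp'_2 (W := prod_NormedModule R_AbsRing F1 F2)
    f g (fun a b => (a, b)) x lf lg (fun a b => (a, b)) Hf Hg _).
  apply filterdiff_linear.
  apply (is_linear_prod (fun t : F1 * F2 => fst t) (fun t : F1 * F2 => snd t)).
  - exact is_linear_fst.
  - exact is_linear_snd.
Qed.

Lemma is_derive_C2R (c : R -> C2) (t : R) (l : C2) :
  is_deriveC (fun r => fst (c r)) t (fst l) ->
  is_deriveC (fun r => snd (c r)) t (snd l) ->
  is_derive (K := R_AbsRing) (V := C2R) c t l.
Proof.
  intros [H1 H2] [H3 H4].
  pose proof (filterdiff_pair _ _ _ _ _
    (filterdiff_pair _ _ _ _ _ H1 H2) (filterdiff_pair _ _ _ _ _ H3 H4)) as H.
  refine (filterdiff_ext_lin _ _ _ (filterdiff_ext _ _ _ _ H) _).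
  - intros y. now destruct (c y) as [[? ?] [? ?]].
  - intros y. now destruct l as [[? ?] [? ?]].
Qed.

Lemma is_derive_C2R_inv (c : R -> C2) (t : R) (l : C2) :
  is_derive (K := R_AbsRing) (V := C2R) c t l ->
  is_deriveC (fun r => fst (c r)) t (fst l) /\
  is_deriveC (fun r => snd (c r)) t (snd l).
Proof.
  intros H.
  assert (L : forall p : C2R -> R, is_linear p ->
            is_derive (fun r => p (c r)) t (p l)).
  { intros p Hp.
    pose proof (filterdiff_comp' c p t _ _ H (filterdiff_linear p Hp)) as H'.
    refine (filterdiff_ext_lin _ _ _ H' _). intros y. apply (linear_scal _ Hp). }
  assert (Lf : is_linear (fun x : C2R => fst x)) by exact is_linear_fst.
  assert (Ls : is_linear (fun x : C2R => snd x)) by exact is_linear_snd.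
  assert (Lr : is_linear (fun x : C_R_NormedModule => fst x)) by exact is_linear_fst.
  assert (Li : is_linear (fun x : C_R_NormedModule => snd x)) by exact is_linear_snd.
  split; split.
  - exact (L (fun x => fst (fst x)) (is_linear_comp _ _ Lf Lr)).
  - exact (L (fun x => snd (fst x)) (is_linear_comp _ _ Lf Li)).
  - exact (L (fun x => fst (snd x)) (is_linear_comp _ _ Ls Lr)).
  - exact (L (fun x => snd (snd x)) (is_linear_comp _ _ Ls Li)).
Qed.

Lemma is_deriveC_curve (F : C2 -> C) (c : R -> C2) (c' : C2) (t : R) :
  is_derive (K := R_AbsRing) (V := C2R) c t c' -> diffC (E := C2R) F (c t) ->
  is_deriveC (fun r => F (c r)) t (dirDC F c' (c t)).
Proof.
  intros Hc [Hr Hi]. split.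
  - exact (is_derive_curve (E := C2R) (fun x => Re (F x)) c c' t Hc Hr).
  - exact (is_derive_curve (E := C2R) (fun x => Im (F x)) c c' t Hc Hi).
Qed.

Lemma is_deriveC_unique (f : R -> C) (t : R) (l l' : C) :
  is_deriveC f t l -> is_deriveC f t l' -> l = l'.
Proof.
  intros [Hr Hi] [Hr' Hi']. apply C_ext.
  - now rewrite <- (is_derive_unique _ _ _ Hr), <- (is_derive_unique _ _ _ Hr').
  - now rewrite <- (is_derive_unique _ _ _ Hi), <- (is_derive_unique _ _ _ Hi').
Qed.

Lemma is_deriveC_ext (f g : R -> C) (t : R) (l : C) :
  (forall r, f r = g r) -> is_deriveC f t l -> is_deriveC g t l.
Proof.
  intros H [Hr Hi]. split.
  - apply is_derive_ext with (2 := Hr). intros r. now rewrite H.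
  - apply is_derive_ext with (2 := Hi). intros r. now rewrite H.
Qed.

Lemma is_deriveC_const (c : C) (t : R) : is_deriveC (fun _ => c) t (RtoC 0).
Proof.
  split; [exact (is_derive_const (Re c) t)|exact (is_derive_const (Im c) t)].
Qed.

Lemma is_deriveC_plus (f g : R -> C) (t : R) (l m : C) :
  is_deriveC f t l -> is_deriveC g t m -> is_deriveC (fun r => f r + g r)%C t (l + m)%C.
Proof.
  intros [Hr Hi] [Gr Gi].
  split; [exact (is_derive_plus _ _ _ _ _ Hr Gr)|exact (is_derive_plus _ _ _ _ _ Hi Gi)].
Qed.

Lemma is_deriveC_opp (f : R -> C) (t : R) (l : C) :
  is_deriveC f t l -> is_deriveC (fun r => - f r)%C t (- l)%C.
Proof.
  intros [Hr Hi].
  split; [exact (is_derive_opp _ _ _ Hr)|exact (is_derive_opp _ _ _ Hi)].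
Qed.

Lemma is_deriveC_minus (f g : R -> C) (t : R) (l m : C) :
  is_deriveC f t l -> is_deriveC g t m -> is_deriveC (fun r => f r - g r)%C t (l - m)%C.
Proof. intros Hf Hg. apply is_deriveC_plus; [|apply is_deriveC_opp]; assumption. Qed.

Lemma is_deriveC_conj (f : R -> C) (t : R) (l : C) :
  is_deriveC f t l -> is_deriveC (fun r => Cconj (f r)) t (Cconj l).
Proof. intros [Hr Hi]. split; [exact Hr|exact (is_derive_opp _ _ _ Hi)]. Qed.

Lemma is_derive_Rmult (f g : R -> R) (t l m : R) :
  is_derive f t l -> is_derive g t m ->
  is_derive (fun r => f r * g r) t (l * g t + f t * m).
Proof. intros Hf Hg. exact (is_derive_mult f g t l m Hf Hg Rmult_comm). Qed.

Lemma is_deriveC_mult (f g : R -> C) (t : R) (l m : C) :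
  is_deriveC f t l -> is_deriveC g t m ->
  is_deriveC (fun r => f r * g r)%C t (l * g t + f t * m)%C.
Proof.
  intros [Hr Hi] [Gr Gi]. split.
  - replace (Re (l * g t + f t * m)%C) with
      ((Re l * Re (g t) + Re (f t) * Re m) - (Im l * Im (g t) + Im (f t) * Im m))
      by (unfold Re, Im; simpl; ring).
    exact (is_derive_minus _ _ _ _ _ (is_derive_Rmult _ _ _ _ _ Hr Gr)
             (is_derive_Rmult _ _ _ _ _ Hi Gi)).
  - replace (Im (l * g t + f t * m)%C) with
      ((Re l * Im (g t) + Re (f t) * Im m) + (Im l * Re (g t) + Im (f t) * Re m))
      by (unfold Re, Im; simpl; ring).
    exact (is_derive_plus _ _ _ _ _ (is_derive_Rmult _ _ _ _ _ Hr Gi)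
             (is_derive_Rmult _ _ _ _ _ Hi Gr)).
Qed.

(** * Functions on the sphere *)

Definition sqnorm (w : C2) : R := Cmod (fst w) ^ 2 + Cmod (snd w) ^ 2.

Lemma sqnorm_eq (w : C2) :
  sqnorm w = Re (fst w) * Re (fst w) + Im (fst w) * Im (fst w)
             + (Re (snd w) * Re (snd w) + Im (snd w) * Im (snd w)).
Proof. unfold sqnorm. rewrite 2!Cmod_sqr. ring. Qed.

Lemma nonzero_sqnorm (w : C2) : nonzero w <-> 0 < sqnorm w.
Proof.
  rewrite sqnorm_eq. destruct w as [[a b] [c d]]; simpl. split.
  - intros Hw. destruct (Rlt_or_le 0 (a * a + b * b + (c * c + d * d))) as [H|H]; [exact H|].
    exfalso. apply Hw. assert (a = 0) by nra. assert (b = 0) by nra.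
    assert (c = 0) by nra. assert (d = 0) by nra. now subst.
  - intros H Hw. injection Hw as -> -> -> ->. lra.
Qed.

Lemma is_linear_fst_fst : is_linear (fun x : C2R => Re (fst x)).
Proof.
  exact (is_linear_comp (fun x : C2R => fst x) (fun x : C_R_NormedModule => fst x)
           is_linear_fst is_linear_fst).
Qed.

Lemma is_linear_snd_fst : is_linear (fun x : C2R => Im (fst x)).
Proof.
  exact (is_linear_comp (fun x : C2R => fst x) (fun x : C_R_NormedModule => snd x)
           is_linear_fst is_linear_snd).
Qed.

Lemma is_linear_fst_snd : is_linear (fun x : C2R => Re (snd x)).
Proof.
  exact (is_linear_comp (fun x : C2R => snd x) (fun x : C_R_NormedModule => fst x)
           is_linear_snd is_linear_fst).
Qed.

Lemma is_linear_snd_snd : is_linear (fun x : C2R => Im (snd x)).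
Proof.
  exact (is_linear_comp (fun x : C2R => snd x) (fun x : C_R_NormedModule => snd x)
           is_linear_snd is_linear_snd).
Qed.

Lemma open_all : open (T := C2R) (fun _ => True).
Proof. apply open_true. Qed.

Lemma smooth_sqnorm (U : C2R -> Prop) : open U -> smooth U sqnorm.
Proof.
  intros HU.
  apply (smooth_ext U HU (fun w => Re (fst w) * Re (fst w) + Im (fst w) * Im (fst w)
             + (Re (snd w) * Re (snd w) + Im (snd w) * Im (snd w)))).
  { intros w _. symmetry. apply sqnorm_eq. }
  pose proof (smooth_linear U HU _ is_linear_fst_fst) as H1.
  pose proof (smooth_linear U HU _ is_linear_snd_fst) as H2.
  pose proof (smooth_linear U HU _ is_linear_fst_snd) as H3.
  pose proof (smooth_linear U HU _ is_linear_snd_snd) as H4.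
  apply (smooth_plus U HU (fun w => Re (fst w) * Re (fst w) + Im (fst w) * Im (fst w))
    (fun w => Re (snd w) * Re (snd w) + Im (snd w) * Im (snd w))).
  - apply (smooth_plus U HU (fun w => Re (fst w) * Re (fst w))
      (fun w => Im (fst w) * Im (fst w))); now apply smooth_mult.
  - apply (smooth_plus U HU (fun w => Re (snd w) * Re (snd w))
      (fun w => Im (snd w) * Im (snd w))); now apply smooth_mult.
Qed.

Lemma open_nonzero : open (T := C2R) nonzero.
Proof.
  apply open_ext with (fun w : C2R => 0 < sqnorm w).
  { intros w. symmetry. apply nonzero_sqnorm. }
  apply (open_comp (T := C2R) (U := R_UniformSpace) sqnorm (fun r => 0 < r)).
  - intros w _. exact (smooth_sqnorm _ open_all 0%nat w I).
  - apply open_gt.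
Qed.

Lemma locally_nonzero (P : C2 -> Prop) (w : C2) :
  nonzero w -> (forall x, nonzero x -> P x) -> locally (T := C2R) w P.
Proof.
  intros Hw H.
  exact (@filter_imp C2R (locally (T := C2R) w) (filter_filter (F := locally (T := C2R) w))
           nonzero P H (open_nonzero w Hw)).
Qed.

Lemma S3_nonzero (w : C2) : S3 w -> nonzero w.
Proof. intros H. apply nonzero_sqnorm. unfold sqnorm. rewrite H. lra. Qed.

Definition invnorm (w : C2) : R := / sqrt (sqnorm w).

Lemma is_derive_inv_sqrt (t : R) :
  0 < t -> is_derive (fun t => / sqrt t) t (- (/ 2) * (/ sqrt t) ^ 3).
Proof.
  intros Ht. assert (Hs : 0 < sqrt t) by now apply sqrt_lt_R0.
  auto_derive; [split; [exact Ht|lra]|]. field. lra.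
Qed.

Lemma filterdiff_invnorm (x : C2) :
  nonzero x -> filterdiff (U := C2R) invnorm (locally x)
    (fun v => dirD (E := C2R) sqnorm v x * (- (/ 2) * (invnorm x) ^ 3)).
Proof.
  intros Hx. pose proof (smooth_sqnorm nonzero open_nonzero) as HN.
  pose proof (filterdiff_dirD (E := C2R) _ x
    (smooth_ex_filterdiff nonzero sqnorm x HN Hx)) as H1.
  apply nonzero_sqnorm in Hx.
  exact (filterdiff_comp' (U := C2R) sqnorm (fun t => / sqrt t) x _ _ H1
           (is_derive_inv_sqrt _ Hx)).
Qed.

(** The derivative of [invnorm] is a smooth function times [invnorm] cubed, so the class of
    [invnorm] itself bounds the class of its derivative and the induction closes. *)
Lemma smooth_invnorm : smooth (E := C2R) nonzero invnorm.
Proof.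
  pose proof (smooth_sqnorm nonzero open_nonzero) as HN.
  pose proof filterdiff_invnorm as HF.
  intros n. induction n as [|n IH].
  - intros x Hx. refine (filterdiff_continuous (K := R_AbsRing) (V := R_NormedModule) invnorm x _).
    eexists. now apply HF.
  - split.
    + intros x Hx. eexists. now apply HF.
    + intros v. apply (Ck_ext (E := C2R) nonzero open_nonzero n
        (fun x => dirD (E := C2R) sqnorm v x *
           (- (/ 2) * (invnorm x * (invnorm x * invnorm x))))).
      * intros x Hx. rewrite (filterdiff_dirD_eq (E := C2R) _ _ v x (HF x Hx)). simpl. ring.
      * apply (Ck_mult (E := C2R) nonzero open_nonzero n).
        { now apply (smooth_dirD (E := C2R) nonzero sqnorm v). }
        apply (Ck_mult (E := C2R) nonzero open_nonzero n (fun _ => - / 2)).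
        { now apply Ck_const, open_nonzero. }
        apply (Ck_mult (E := C2R) nonzero open_nonzero n); [exact IH|].
        now apply (Ck_mult (E := C2R) nonzero open_nonzero n).
Qed.

Definition norm2 (w : C2) : R := sqrt (sqnorm w).

Lemma norm2_pos (w : C2) : nonzero w -> 0 < norm2 w.
Proof. intros H. now apply sqrt_lt_R0, nonzero_sqnorm. Qed.

(** Writing the norm as [sqnorm * invnorm] avoids a second induction for the square root. *)
Lemma smooth_norm2 : smooth (E := C2R) nonzero norm2.
Proof.
  apply (smooth_ext (E := C2R) nonzero open_nonzero (fun w => sqnorm w * invnorm w)).
  - intros w Hw. pose proof (norm2_pos w Hw) as Hp. unfold norm2, invnorm in *.
    apply nonzero_sqnorm in Hw. rewrite <- (sqrt_sqrt (sqnorm w)) at 1 by lra. field. lra.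
  - apply (smooth_mult (E := C2R) nonzero open_nonzero sqnorm invnorm).
    + apply smooth_sqnorm, open_nonzero.
    + apply smooth_invnorm.
Qed.

Lemma normalize_scal (w : C2) :
  nonzero w -> normalize w = scal (V := C2R) (invnorm w) w.
Proof.
  intros Hw. pose proof (norm2_pos w Hw) as Hp. unfold normalize.
  change (Cmod (fst w) ^ 2 + Cmod (snd w) ^ 2) with (sqnorm w).
  unfold invnorm, norm2 in *. destruct w as [[a b] [c d]].
  simpl fst; simpl snd. set (r := sqrt _) in *.
  assert (HC : forall p q : R, ((p, q) / RtoC r)%C = (/ r * p, / r * q)).
  { intros p q. apply C_ext; simpl; field; lra. }
  now rewrite !HC.
Qed.

Lemma scal_C2 (r : R) (w : C2) :
  scal (V := C2R) r w = (RtoC r * fst w, RtoC r * snd w)%C.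
Proof.
  destruct w as [[a b] [c d]]. apply injective_projections; apply C_ext.
  - change (r * a = r * a - 0 * b). ring.
  - change (r * b = r * b + 0 * a). ring.
  - change (r * c = r * c - 0 * d). ring.
  - change (r * d = r * d + 0 * c). ring.
Qed.

Lemma sqnorm_scal (r : R) (w : C2) : sqnorm (scal (V := C2R) r w) = r * r * sqnorm w.
Proof.
  rewrite scal_C2, !sqnorm_eq. destruct w as [[a b] [c d]]. simpl. ring.
Qed.

Lemma nonzero_scal (r : R) (w : C2) : 0 < r -> nonzero w -> nonzero (scal (V := C2R) r w).
Proof.
  intros Hr Hw. apply nonzero_sqnorm. rewrite sqnorm_scal. apply nonzero_sqnorm in Hw.
  repeat apply Rmult_lt_0_compat; assumption.
Qed.

Lemma S3_sqnorm (w : C2) : S3 w <-> sqnorm w = 1.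
Proof. reflexivity. Qed.

Lemma normalize_S3 (w : C2) : nonzero w -> S3 (normalize w).
Proof.
  intros Hw. rewrite normalize_scal, S3_sqnorm, sqnorm_scal by exact Hw.
  pose proof (norm2_pos w Hw) as Hp. unfold invnorm, norm2 in *.
  apply nonzero_sqnorm in Hw. 
  pose proof (sqrt_sqrt (sqnorm w) (Rlt_le _ _ Hw)) as Hq.
  set (r := sqrt (sqnorm w)) in *. rewrite <- Hq. field. lra.
Qed.

Lemma normalize_id (w : C2) : S3 w -> normalize w = w.
Proof.
  intros Hw. rewrite normalize_scal by now apply S3_nonzero.
  unfold invnorm. rewrite S3_sqnorm in Hw. rewrite Hw, sqrt_1, Rinv_1.
  apply (scal_one (V := C2R)).
Qed.

Lemma normalize_pos_scal (r : R) (w : C2) :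
  0 < r -> nonzero w -> normalize (scal (V := C2R) r w) = normalize w.
Proof.
  intros Hr Hw. pose proof (nonzero_scal r w Hr Hw) as Hrw.
  rewrite !normalize_scal by assumption. rewrite (scal_assoc (V := C2R)). f_equal.
  unfold invnorm. rewrite sqnorm_scal. pose proof (norm2_pos w Hw) as Hp.
  unfold norm2 in Hp. apply nonzero_sqnorm in Hw.
  rewrite sqrt_mult, sqrt_square by first [lra | apply Rle_0_sqr].
  change (/ (r * sqrt (sqnorm w)) * r = / sqrt (sqnorm w)). field. lra.
Qed.

Lemma radial_S3 {T : Type} (f : C2 -> T) (w : C2) : S3 w -> radial f w = f w.
Proof. intros H. unfold radial. now rewrite normalize_id. Qed.

Lemma radial_ext {T : Type} (f g : C2 -> T) (w : C2) :
  (forall x, S3 x -> f x = g x) -> nonzero w -> radial f w = radial g w.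
Proof. intros H Hw. now apply H, normalize_S3. Qed.

(** Agreement on the sphere spreads along rays to the open set [nonzero]; this makes every
    derivative below depend only on values on [S3]. *)
Lemma dirDC_radial_ext (f g : C2 -> C) (v w : C2) :
  (forall x, S3 x -> f x = g x) -> nonzero w ->
  dirDC (radial f) v w = dirDC (radial g) v w.
Proof.
  intros H Hw. apply dirDC_ext_loc.
  apply locally_nonzero; [exact Hw|]. intros x. now apply radial_ext.
Qed.

Lemma smooth_fun_S3_ext (f g : C2 -> C) :
  (forall x, S3 x -> f x = g x) -> smooth_fun_S3 f -> smooth_fun_S3 g.
Proof.
  intros H. apply smoothC_ext; [exact open_nonzero|].
  intros x. now apply radial_ext.
Qed.

Lemma smooth_fun_S3_const (c : C) : smooth_fun_S3 (fun _ => c).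
Proof. apply (smoothC_const (E := C2R) nonzero open_nonzero). Qed.

Lemma smooth_fun_S3_plus (f g : C2 -> C) :
  smooth_fun_S3 f -> smooth_fun_S3 g -> smooth_fun_S3 (fun x => f x + g x)%C.
Proof. apply (smoothC_plus (E := C2R) nonzero open_nonzero). Qed.

Lemma smooth_fun_S3_opp (f : C2 -> C) :
  smooth_fun_S3 f -> smooth_fun_S3 (fun x => - f x)%C.
Proof. apply (smoothC_opp (E := C2R) nonzero open_nonzero). Qed.

Lemma smooth_fun_S3_minus (f g : C2 -> C) :
  smooth_fun_S3 f -> smooth_fun_S3 g -> smooth_fun_S3 (fun x => f x - g x)%C.
Proof. apply (smoothC_minus (E := C2R) nonzero open_nonzero). Qed.

Lemma smooth_fun_S3_mult (f g : C2 -> C) :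
  smooth_fun_S3 f -> smooth_fun_S3 g -> smooth_fun_S3 (fun x => f x * g x)%C.
Proof. apply (smoothC_mult (E := C2R) nonzero open_nonzero). Qed.

Lemma smooth_fun_S3_conj (f : C2 -> C) :
  smooth_fun_S3 f -> smooth_fun_S3 (fun x => Cconj (f x)).
Proof. apply (smoothC_conj (E := C2R) nonzero open_nonzero). Qed.

Lemma smooth_normalize_component (l : C2R -> R) :
  is_linear l -> smooth (E := C2R) nonzero (fun x => l (normalize x)).
Proof.
  intros Hl. apply (smooth_ext (E := C2R) nonzero open_nonzero (fun x => invnorm x * l x)).
  - intros x Hx. rewrite normalize_scal by exact Hx. symmetry. apply (linear_scal l Hl).
  - apply (smooth_mult (E := C2R) nonzero open_nonzero invnorm l).
    + exact smooth_invnorm.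
    + exact (smooth_linear nonzero open_nonzero l Hl).
Qed.

Lemma smooth_fun_S3_fst : smooth_fun_S3 (fun x => fst x).
Proof.
  split.
  - exact (smooth_normalize_component _ is_linear_fst_fst).
  - exact (smooth_normalize_component _ is_linear_snd_fst).
Qed.

Lemma smooth_fun_S3_snd : smooth_fun_S3 (fun x => snd x).
Proof.
  split.
  - exact (smooth_normalize_component _ is_linear_fst_snd).
  - exact (smooth_normalize_component _ is_linear_snd_snd).
Qed.

Lemma smooth_fun_S3_diffC (f : C2 -> C) (w : C2) :
  smooth_fun_S3 f -> nonzero w -> diffC (E := C2R) (radial f) w.
Proof. apply (smoothC_diffC (E := C2R)). Qed.

(* [radial f] is homogeneous of degree 0, hence its derivatives have degree -1. *)
Lemma dirDC_radial_normalize (f : C2 -> C) (v w : C2) :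
  smooth_fun_S3 f -> nonzero w ->
  dirDC (radial f) v (normalize w) = (RtoC (norm2 w) * dirDC (radial f) v w)%C.
Proof.
  intros Hf Hw. pose proof (norm2_pos w Hw) as Hr.
  rewrite <- dirDC_scal_dir by now apply smooth_fun_S3_diffC.
  assert (Hc : locally 0 (fun t : R => nonzero
            (plus (G := C2R) w (scal t (scal (norm2 w) v))))).
  { apply (locally_line (E := C2R) nonzero). rewrite (line_at_0 (E := C2R)).
    now apply open_nonzero. }
  assert (Hn : forall t : R, nonzero (plus (G := C2R) w (scal t (scal (norm2 w) v))) ->
    radial f (plus (G := C2R) (normalize w) (scal t v)) =
    radial f (plus (G := C2R) w (scal t (scal (norm2 w) v)))).
  { intros t Ht. unfold radial. f_equal.
    rewrite <- (normalize_pos_scal (invnorm w) (plus (G := C2R) w _)).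
    - f_equal. rewrite normalize_scal by exact Hw.
      rewrite (scal_distr_l (V := C2R)), !(scal_assoc (V := C2R)). f_equal. f_equal.
      unfold invnorm, norm2 in *. change (t = / sqrt (sqnorm w) * t * sqrt (sqnorm w)).
      field. lra.
    - now apply Rinv_0_lt_compat.
    - exact Ht. }
  apply C_ext; apply Derive_ext_loc; apply filter_imp with (2 := Hc);
    intros t Ht; now rewrite Hn.
Qed.

(** A derivative of a radial function has degree -1, so it is not its own radial extension; the two
    differ by the factor [norm2], which is smooth off the origin. *)
Lemma smooth_fun_S3_dirDC (f : C2 -> C) (v : C2) :
  smooth_fun_S3 f -> smooth_fun_S3 (dirDC (radial f) v).
Proof.
  intros Hf.
  apply (smoothC_ext (E := C2R) nonzero open_nonzero
    (fun w => RtoC (norm2 w) * dirDC (radial f) v w)%C).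
  - intros w Hw. symmetry. now apply dirDC_radial_normalize.
  - apply (smoothC_mult (E := C2R) nonzero open_nonzero (fun w => RtoC (norm2 w))).
    + exact (smoothC_RtoC (E := C2R) nonzero open_nonzero norm2 smooth_norm2).
    + destruct Hf as [Hr Hi].
      split; now apply (smooth_dirD (E := C2R)).
Qed.

Lemma smooth_fun_S3_dw (e : C2) (f : C2 -> C) :
  smooth_fun_S3 f -> smooth_fun_S3 (dw e (radial f)).
Proof.
  intros Hf.
  apply (smooth_fun_S3_mult (fun w => dirDC (radial f) e w
    - Ci * dirDC (radial f) (C2scal Ci e) w)%C (fun _ => / 2)%C);
    [|apply smooth_fun_S3_const].
  apply smooth_fun_S3_minus; [now apply smooth_fun_S3_dirDC|].
  apply (smooth_fun_S3_mult (fun _ => Ci)); [apply smooth_fun_S3_const|].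
  now apply smooth_fun_S3_dirDC.
Qed.

Lemma smooth_fun_S3_dwbar (e : C2) (f : C2 -> C) :
  smooth_fun_S3 f -> smooth_fun_S3 (dwbar e (radial f)).
Proof.
  intros Hf.
  apply (smooth_fun_S3_mult (fun w => dirDC (radial f) e w
    + Ci * dirDC (radial f) (C2scal Ci e) w)%C (fun _ => / 2)%C);
    [|apply smooth_fun_S3_const].
  apply smooth_fun_S3_plus; [now apply smooth_fun_S3_dirDC|].
  apply (smooth_fun_S3_mult (fun _ => Ci)); [apply smooth_fun_S3_const|].
  now apply smooth_fun_S3_dirDC.
Qed.

Lemma smooth_fun_S3_act (X : C2 -> ctvec) (f : C2 -> C) :
  smooth_fun_S3 (fun w => fst (dw_part (X w))) ->
  smooth_fun_S3 (fun w => snd (dw_part (X w))) ->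
  smooth_fun_S3 (fun w => fst (dwbar_part (X w))) ->
  smooth_fun_S3 (fun w => snd (dwbar_part (X w))) ->
  smooth_fun_S3 f -> smooth_fun_S3 (fun w => act (X w) f w).
Proof.
  intros H1 H2 H3 H4 Hf. unfold act.
  apply smooth_fun_S3_plus; [apply smooth_fun_S3_plus; [apply smooth_fun_S3_plus|]|].
  - apply (smooth_fun_S3_mult (fun w => fst (dw_part (X w)))); [exact H1|now apply smooth_fun_S3_dw].
  - apply (smooth_fun_S3_mult (fun w => snd (dw_part (X w)))); [exact H2|now apply smooth_fun_S3_dw].
  - apply (smooth_fun_S3_mult (fun w => fst (dwbar_part (X w)))); [exact H3|now apply smooth_fun_S3_dwbar].
  - apply (smooth_fun_S3_mult (fun w => snd (dwbar_part (X w)))); [exact H4|now apply smooth_fun_S3_dwbar].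
Qed.

Lemma smooth_fun_S3_lie_W0 (f : C2 -> C) : smooth_fun_S3 f -> smooth_fun_S3 (lie W0 f).
Proof.
  intros Hf. apply smooth_fun_S3_act; [| | | |exact Hf].
  - apply (smooth_fun_S3_conj (fun w => snd w)), smooth_fun_S3_snd.
  - apply (smooth_fun_S3_opp (fun w => Cconj (fst w))).
    apply (smooth_fun_S3_conj (fun w => fst w)), smooth_fun_S3_fst.
  - apply (smooth_fun_S3_const (RtoC 0)).
  - apply (smooth_fun_S3_const (RtoC 0)).
Qed.

Lemma smooth_fun_S3_lie_W0bar (f : C2 -> C) : smooth_fun_S3 f -> smooth_fun_S3 (lie W0bar f).
Proof.
  intros Hf. apply smooth_fun_S3_act; [| | | |exact Hf].
  - apply (smooth_fun_S3_const (RtoC 0)).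
  - apply (smooth_fun_S3_const (RtoC 0)).
  - apply smooth_fun_S3_snd.
  - apply (smooth_fun_S3_opp (fun w => fst w)), smooth_fun_S3_fst.
Qed.

(** * Complex tangent vectors acting on functions *)

Definition C2conj (v : C2) : C2 := (Cconj (fst v), Cconj (snd v)).

Definition realvec (v : C2) : ctvec := CTVec v (C2conj v).

(** Real-linear expansion of [v] in e1, i e1, e2, i e2. This is the bridge between [act], defined by
    Wirtinger derivatives, and derivatives along curves. *)
Lemma act_realvec (f : C2 -> C) (v w : C2) :
  smooth_fun_S3 f -> nonzero w -> act (realvec v) f w = dirDC (radial f) v w.
Proof.
  intros Hf Hw. pose proof (smooth_fun_S3_diffC f w Hf Hw) as Hd.
  destruct v as [[a b] [c d]].
  transitivity (dirDC (radial f)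
    (plus (G := C2R) (plus (scal (V := C2R) a e1) (scal (V := C2R) b (C2scal Ci e1)))
       (plus (scal (V := C2R) c e2) (scal (V := C2R) d (C2scal Ci e2)))) w).
  - rewrite !dirDC_plus_dir, !dirDC_scal_dir by exact Hd.
    unfold act, dw, dwbar, realvec, C2conj; simpl dw_part; simpl dwbar_part; simpl fst; simpl snd.
    set (x1 := dirDC _ e1 w). set (x2 := dirDC _ e2 w).
    set (y1 := dirDC _ (C2scal Ci e1) w). set (y2 := dirDC _ (C2scal Ci e2) w).
    destruct x1, x2, y1, y2. apply C_ext; simpl; field.
  - f_equal. rewrite !scal_C2.
    apply injective_projections; apply C_ext; simpl; unfold plus; simpl; ring.
Qed.

Lemma act_add (X Y : ctvec) (f : C2 -> C) (w : C2) :
  act (ctadd X Y) f w = (act X f w + act Y f w)%C.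
Proof. unfold act; simpl. ring. Qed.

Lemma act_scal (c : C) (X : ctvec) (f : C2 -> C) (w : C2) :
  act (ctscal c X) f w = (c * act X f w)%C.
Proof. unfold act; simpl. ring. Qed.

Lemma act_sub (X Y : ctvec) (f : C2 -> C) (w : C2) :
  act (ctsub X Y) f w = (act X f w - act Y f w)%C.
Proof.
  unfold ctsub. rewrite act_add, act_scal. ring.
Qed.

Lemma act_ext (X : ctvec) (f g : C2 -> C) (w : C2) :
  (forall x, S3 x -> f x = g x) -> nonzero w -> act X f w = act X g w.
Proof.
  intros H Hw. unfold act, dw, dwbar.
  now rewrite !(dirDC_radial_ext f g _ w H Hw).
Qed.

Lemma act_mult (X : ctvec) (f g : C2 -> C) (w : C2) :
  smooth_fun_S3 f -> smooth_fun_S3 g -> S3 w ->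
  act X (fun x => f x * g x)%C w = (act X f w * g w + f w * act X g w)%C.
Proof.
  intros Hf Hg Hw.
  assert (H : forall v, dirDC (radial (fun x => f x * g x)%C) v w =
    (dirDC (radial f) v w * g w + f w * dirDC (radial g) v w)%C).
  { intros v. rewrite <- (radial_S3 f w Hw), <- (radial_S3 g w Hw).
    apply (dirDC_mult (radial f) (radial g));
      apply smooth_fun_S3_diffC; (assumption || now apply S3_nonzero). }
  unfold act, dw, dwbar. rewrite !H. unfold Cdiv. ring.
Qed.

Lemma act_plus (X : ctvec) (f g : C2 -> C) (w : C2) :
  smooth_fun_S3 f -> smooth_fun_S3 g -> nonzero w ->
  act X (fun x => f x + g x)%C w = (act X f w + act X g w)%C.
Proof.
  intros Hf Hg Hw.
  assert (H : forall v, dirDC (radial (fun x => f x + g x)%C) v w =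
    (dirDC (radial f) v w + dirDC (radial g) v w)%C).
  { intros v. apply (dirDC_plus (radial f) (radial g)); now apply smooth_fun_S3_diffC. }
  unfold act, dw, dwbar. rewrite !H. unfold Cdiv. ring.
Qed.

Lemma act_const (X : ctvec) (c : C) (w : C2) : act X (fun _ => c) w = RtoC 0.
Proof.
  assert (H : forall v, dirDC (radial (fun _ => c)) v w = RtoC 0).
  { intros v. apply (dirDC_const c). }
  unfold act, dw, dwbar. rewrite !H. unfold Cdiv. ring.
Qed.

Lemma act_scal_fun (X : ctvec) (c : C) (f : C2 -> C) (w : C2) :
  smooth_fun_S3 f -> S3 w -> act X (fun x => c * f x)%C w = (c * act X f w)%C.
Proof.
  intros Hf Hw. rewrite (act_mult X (fun _ => c)); [|apply smooth_fun_S3_const|exact Hf|exact Hw].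
  rewrite act_const. ring.
Qed.

Lemma act_minus (X : ctvec) (f g : C2 -> C) (w : C2) :
  smooth_fun_S3 f -> smooth_fun_S3 g -> S3 w ->
  act X (fun x => f x - g x)%C w = (act X f w - act X g w)%C.
Proof.
  intros Hf Hg Hw.
  rewrite (act_ext X _ (fun x => f x + (- (1)) * g x)%C);
    [|intros; ring|now apply S3_nonzero].
  rewrite act_plus, act_scal_fun; [ring|assumption..| |now apply S3_nonzero].
  now apply (smooth_fun_S3_mult (fun _ => - (1))%C), Hg; apply smooth_fun_S3_const.
Qed.

Lemma Cconj_Ci : Cconj Ci = (- Ci)%C.
Proof. apply C_ext; simpl; ring. Qed.

Lemma lie_W0_conj (f : C2 -> C) (w : C2) :
  lie W0 (fun x => Cconj (f x)) w = Cconj (lie W0bar f w).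
Proof.
  assert (H : forall v, dirDC (radial (fun x => Cconj (f x))) v w =
    Cconj (dirDC (radial f) v w)) by (intros v; apply dirDC_conj).
  unfold lie, act, dw, dwbar, W0, W0bar; simpl. rewrite !H.
  destruct (dirDC (radial f) e1 w), (dirDC (radial f) e2 w),
    (dirDC (radial f) (C2scal Ci e1) w), (dirDC (radial f) (C2scal Ci e2) w), w as [[] []].
  apply C_ext; simpl; field.
Qed.

Lemma lie_W0bar_conj (f : C2 -> C) (w : C2) :
  lie W0bar (fun x => Cconj (f x)) w = Cconj (lie W0 f w).
Proof.
  assert (H : forall v, dirDC (radial (fun x => Cconj (f x))) v w =
    Cconj (dirDC (radial f) v w)) by (intros v; apply dirDC_conj).
  unfold lie, act, dw, dwbar, W0, W0bar; simpl. rewrite !H.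
  destruct (dirDC (radial f) e1 w), (dirDC (radial f) e2 w),
    (dirDC (radial f) (C2scal Ci e1) w), (dirDC (radial f) (C2scal Ci e2) w), w as [[] []].
  apply C_ext; simpl; field.
Qed.

Lemma is_deriveC_S3_curve (f : C2 -> C) (c : R -> C2) (c' : C2) (t : R) :
  smooth_fun_S3 f -> (forall r, S3 (c r)) ->
  is_derive (K := R_AbsRing) (V := C2R) c t c' ->
  is_deriveC (fun r => f (c r)) t (act (realvec c') f (c t)).
Proof.
  intros Hf Hc Hd. rewrite act_realvec; [|exact Hf|now apply S3_nonzero].
  apply is_deriveC_ext with (fun r => radial f (c r)).
  - intros r. now apply radial_S3.
  - apply is_deriveC_curve; [exact Hd|].
    apply smooth_fun_S3_diffC; [exact Hf|now apply S3_nonzero].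
Qed.

(* The contact plane at [w] consists of the real vectors
   [hvec c w] = c W_0 + cbar W_0bar. *)
Definition hvec (c : C) (w : C2) : C2 := C2scal c (Cconj (snd w), - Cconj (fst w))%C.

Lemma act_hvec (c : C) (f : C2 -> C) (w : C2) :
  act (realvec (hvec c w)) f w = (c * lie W0 f w + Cconj c * lie W0bar f w)%C.
Proof.
  unfold lie, act, realvec, hvec, C2conj, C2scal; simpl.
  rewrite !Cmult_conj, Copp_conj, !Cconj_conj. ring.
Qed.

Lemma dirD_sqnorm (v w : C2) : tangent w v -> dirD (E := C2R) sqnorm v w = 0.
Proof.
  destruct w as [[a b] [c d]], v as [[p q] [r s]]. intros Ht.
  unfold tangent in Ht. simpl in Ht.
  unfold dirD.
  transitivity (Derive (fun t : R => (a + t * p) * (a + t * p) + (b + t * q) * (b + t * q)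
     + ((c + t * r) * (c + t * r) + (d + t * s) * (d + t * s))) 0).
  - apply Derive_ext. intros t. rewrite sqnorm_eq. reflexivity.
  - apply is_derive_unique. auto_derive; [exact I|]. lra.
Qed.

Lemma dirD_invnorm (v w : C2) :
  nonzero w -> tangent w v -> dirD (E := C2R) invnorm v w = 0.
Proof.
  intros Hw Ht.
  rewrite (filterdiff_dirD_eq (E := C2R) _ _ v w (filterdiff_invnorm w Hw)).
  rewrite dirD_sqnorm by exact Ht. ring.
Qed.

(** On the sphere [invnorm] is 1 and its tangential derivative vanishes, so normalization acts as
    the identity on tangent vectors. *)
Lemma dirD_normalize_component (l : C2R -> R) (v w : C2) :
  is_linear l -> S3 w -> tangent w v ->
  dirD (E := C2R) (fun x => l (normalize x)) v w = l v.
Proof.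
  intros Hl Hw Ht. pose proof (S3_nonzero w Hw) as Hn.
  transitivity (dirD (E := C2R) (fun x => invnorm x * l x) v w).
  - apply (dirD_ext_loc (E := C2R)). apply locally_nonzero; [exact Hn|].
    intros x Hx. rewrite normalize_scal by exact Hx. apply (linear_scal l Hl).
  - rewrite (dirD_mult (E := C2R)).
    + rewrite dirD_invnorm by assumption.
      rewrite (filterdiff_dirD_eq (E := C2R) l l v w (filterdiff_linear l Hl)).
      unfold invnorm. rewrite (proj1 (S3_sqnorm w) Hw), sqrt_1. field.
    + exact (smooth_ex_filterdiff (E := C2R) nonzero invnorm w smooth_invnorm Hn).
    + exact (ex_filterdiff_linear l Hl).
Qed.

Lemma dirDC_radial_fst (v w : C2) :
  S3 w -> tangent w v -> dirDC (radial (fun x => fst x)) v w = fst v.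
Proof.
  intros Hw Ht. apply C_ext.
  - exact (dirD_normalize_component _ v w is_linear_fst_fst Hw Ht).
  - exact (dirD_normalize_component _ v w is_linear_snd_fst Hw Ht).
Qed.

Lemma dirDC_radial_snd (v w : C2) :
  S3 w -> tangent w v -> dirDC (radial (fun x => snd x)) v w = snd v.
Proof.
  intros Hw Ht. apply C_ext.
  - exact (dirD_normalize_component _ v w is_linear_fst_snd Hw Ht).
  - exact (dirD_normalize_component _ v w is_linear_snd_snd Hw Ht).
Qed.

Lemma tangent_hvec (c : C) (w : C2) : tangent w (hvec c w).
Proof.
  destruct w as [[] []], c. unfold tangent, hvec, C2scal. simpl. ring.
Qed.

Lemma eta_hvec (c : C) (w : C2) : eta w (hvec c w) = 0.
Proof.
  destruct w as [[] []], c. unfold eta, hvec, C2scal. simpl. ring.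
Qed.

(** The values at c = 1 and c = i separate the complex-linear from the antilinear part.
    Geometrically: what is known along all real contact vectors determines the action of [W0] and of
    [W0bar] separately. *)
Lemma conj_linear_eq (A B a b : C) :
  (forall c : C, c * A + Cconj c * B = c * a + Cconj c * b)%C -> A = a /\ B = b.
Proof.
  intros H. pose proof (H (RtoC 1)) as H1. pose proof (H Ci) as Hi.
  destruct A, B, a, b. injection H1 as H1 H2. injection Hi as H3 H4. simpl in *.
  split; apply C_ext; simpl; lra.
Qed.

(** Off the sphere [fst] differs from its radial extension, so a direct Wirtinger computation does
    not apply; the values are found along the tangent vectors [hvec c w] and then separated. *)
Lemma lie_fst (w : C2) :
  S3 w -> lie W0 (fun x => fst x) w = Cconj (snd w) /\
          lie W0bar (fun x => fst x) w = RtoC 0.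
Proof.
  intros Hw. apply conj_linear_eq. intros c.
  rewrite <- act_hvec, act_realvec; [|apply smooth_fun_S3_fst|now apply S3_nonzero].
  rewrite dirDC_radial_fst; [|exact Hw|apply tangent_hvec].
  unfold hvec, C2scal; simpl. ring.
Qed.

Lemma lie_snd (w : C2) :
  S3 w -> lie W0 (fun x => snd x) w = (- Cconj (fst w))%C /\
          lie W0bar (fun x => snd x) w = RtoC 0.
Proof.
  intros Hw. apply conj_linear_eq. intros c.
  rewrite <- act_hvec, act_realvec; [|apply smooth_fun_S3_snd|now apply S3_nonzero].
  rewrite dirDC_radial_snd; [|exact Hw|apply tangent_hvec].
  unfold hvec, C2scal; simpl. ring.
Qed.

(** * Derivative of a flow *)

Definition RC2 : NormedModule R_AbsRing :=
  prod_NormedModule R_AbsRing R_NormedModule C2R.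

Definition time_nonzero (x : RC2) : Prop := nonzero (snd x).

Lemma open_time_nonzero : open time_nonzero.
Proof.
  apply (open_comp (T := RC2) (U := C2R) (fun x => snd x) nonzero).
  - intros x _. apply (continuous_snd (U := R_UniformSpace) (V := C2R)).
  - exact open_nonzero.
Qed.

Lemma dirD_time (phi : RC2 -> R) (s : R) (x : C2) :
  dirD (E := RC2) phi (1, zero) (s, x) = Derive (fun r => phi (r, x)) s.
Proof.
  unfold dirD. 
  transitivity (Derive (fun t => phi (s + t, x)) 0).
  - apply Derive_ext. intros t. f_equal. apply injective_projections.
    + change (s + t * 1 = s + t). ring.
    + change (plus (G := C2R) x (scal t zero) = x).
      rewrite (scal_zero_r (V := C2R)). apply (plus_zero_r (G := C2R)).
  - unfold Derive. f_equal. apply Lim_ext. intros h. now rewrite !Rplus_0_r, Rplus_0_l.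
Qed.

Lemma dirD_space (phi : RC2 -> R) (s : R) (v w : C2) :
  dirD (E := RC2) phi (0, v) (s, w) = dirD (E := C2R) (fun x => phi (s, x)) v w.
Proof.
  apply Derive_ext. intros t. f_equal. apply injective_projections; [|reflexivity].
  change (s + t * 0 = s). ring.
Qed.

(** Symmetry of second derivatives on R x C^2, for the directions (0, v) and (1, 0). It needs joint
    smoothness in time and space. *)
Lemma is_derive_dirD_time (phi : RC2 -> R) (s : R) (v w : C2) :
  smooth time_nonzero phi -> nonzero w ->
  is_derive (fun r => dirD (E := C2R) (fun x => phi (r, x)) v w) s
    (dirD (E := C2R) (fun x => Derive (fun r => phi (r, x)) s) v w).
Proof.
  intros Hphi Hw.
  assert (Hc : is_derive (K := R_AbsRing) (V := RC2) (fun r => (r, w)) s (1, zero)).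
  { pose proof (filterdiff_pair (fun r : R => r) (fun _ : R => w) s _ _
      (filterdiff_id _) (filterdiff_const (V := C2R) w)) as H.
    refine (filterdiff_ext_lin _ _ _ H _). intros y. apply injective_projections.
    - exact (eq_sym (Rmult_1_r y)).
    - symmetry. apply (scal_zero_r (V := C2R)). }
  assert (Hd : smooth time_nonzero (dirD phi (0, v))) by now apply smooth_dirD.
  pose proof (is_derive_curve (E := RC2) (dirD phi (0, v)) _ _ s Hc
    (smooth_ex_filterdiff _ _ (s, w) Hd Hw)) as H.
  rewrite (dirD_comm time_nonzero open_time_nonzero phi _ _ (s, w) Hphi Hw) in H.
  rewrite dirD_space in H.
  replace (dirD (E := C2R) (fun x => Derive (fun r => phi (r, x)) s) v w)
    with (dirD (E := C2R) (fun x => dirD (E := RC2) phi (1, zero) (s, x)) v w).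
  - apply is_derive_ext with (2 := H). intros r. apply dirD_space.
  - apply (dirD_ext_loc (E := C2R)), filter_forall. intros x. apply dirD_time.
Qed.

Section Flow.

Variables (V : C2 -> C2) (g : R -> C2 -> C2).
Hypothesis V_field : smooth_vector_field V.
Hypothesis g_flow : contact_flow V g.

Lemma flow_S3 (s : R) (w : C2) : S3 w -> S3 (g s w).
Proof. apply (ct_maps _ (cf_contact _ _ g_flow s)). Qed.

Lemma smooth_fun_S3_V1 : smooth_fun_S3 (fun x => fst (V x)).
Proof. exact (proj1 (vf_smooth _ V_field)). Qed.

Lemma smooth_fun_S3_V2 : smooth_fun_S3 (fun x => snd (V x)).
Proof. exact (proj2 (vf_smooth _ V_field)). Qed.

Lemma smooth_fun_S3_g1 (s : R) : smooth_fun_S3 (fun x => fst (g s x)).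
Proof. exact (proj1 (ct_smooth _ (cf_contact _ _ g_flow s))). Qed.

Lemma smooth_fun_S3_g2 (s : R) : smooth_fun_S3 (fun x => snd (g s x)).
Proof. exact (proj2 (ct_smooth _ (cf_contact _ _ g_flow s))). Qed.

Lemma is_deriveC_along_flow (h : C2 -> C) (s : R) (w : C2) :
  smooth_fun_S3 h -> S3 w ->
  is_deriveC (fun t => h (g t w)) s (act (realvec (V (g s w))) h (g s w)).
Proof.
  intros Hh Hw. apply is_deriveC_S3_curve; [exact Hh| |].
  - intros r. now apply flow_S3.
  - now apply (cf_generated _ _ g_flow).
Qed.

Lemma is_derive_line_flow (s : R) (v w : C2) :
  nonzero w ->
  is_derive (K := R_AbsRing) (V := C2R)
    (fun t => radial (g s) (plus (G := C2R) w (scal (V := C2R) t v))) 0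
    (differential (g s) w v).
Proof.
  intros Hw.
  destruct (smooth_fun_S3_diffC _ w (smooth_fun_S3_g1 s) Hw) as [D1 D2].
  destruct (smooth_fun_S3_diffC _ w (smooth_fun_S3_g2 s) Hw) as [D3 D4].
  assert (L : forall f : C2R -> R, ex_filterdiff f (locally w) ->
    is_derive (fun t : R => f (plus w (scal t v))) 0 (dirD f v w)).
  { intros f Hf. pose proof (is_derive_line (E := C2R) f v w 0) as H.
    rewrite (line_at_0 (E := C2R)) in H. now apply H. }
  apply is_derive_C2R; split.
  - exact (L _ D1).
  - exact (L _ D2).
  - exact (L _ D3).
  - exact (L _ D4).
Qed.

(** The variational equation d/ds (dg_s v) = dV (dg_s v), tested against a real coordinate [l]: time
    and space derivatives are exchanged, then the flow equation is differentiated by the chain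
    rule. *)
Lemma is_derive_dirD_flow (l : C2R -> R) (s : R) (v w : C2) :
  is_linear l ->
  smooth time_nonzero (fun x : RC2 => l (radial (g (fst x)) (snd x))) ->
  smooth (E := C2R) nonzero (radial (fun x => l (V x))) -> S3 w ->
  is_derive (fun r => dirD (E := C2R) (fun x => l (radial (g r) x)) v w) s
    (dirD (E := C2R) (radial (fun x => l (V x))) (differential (g s) w v) (g s w)).
Proof.
  intros Hl Hg HV Hw. pose proof (S3_nonzero w Hw) as Hn.
  pose proof (is_derive_dirD_time _ s v w Hg Hn) as H. simpl in H.
  (* The flow equation is given on the sphere only; through [normalize] it holds on an open set, as
     required for differentiating it in space. *)
  assert (Hlp : forall x, nonzero x -> Derive (fun r => l (radial (g r) x)) s
            = radial (fun x => l (V x)) (radial (g s) x)).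
  { intros x Hx. pose proof (normalize_S3 x Hx) as Sx.
    rewrite radial_S3 by now apply flow_S3.
    pose proof (cf_generated _ _ g_flow s _ Sx) as Hd.
    pose proof (filterdiff_comp' _ l s _ _ Hd (filterdiff_linear l Hl)) as H'.
    apply is_derive_unique. refine (filterdiff_ext_lin _ _ _ H' _).
    intros y. apply (linear_scal _ Hl). }
  pose proof (is_derive_line_flow s v w Hn) as Hc.
  assert (E0 : radial (g s) (plus (G := C2R) w (scal (V := C2R) 0 v)) = g s w).
  { rewrite (line_at_0 (E := C2R)). now apply radial_S3. }
  assert (Hsn : nonzero (g s w)) by now apply S3_nonzero, flow_S3.
  (* Chain rule along the image of the line w + t v, whose velocity at t = 0 is
     [differential (g s) w v]. *)
  pose proof (is_derive_curve (E := C2R) (radial (fun x => l (V x))) _ _ 0 Hc) as Hk.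
  cbv beta in Hk. rewrite E0 in Hk.
  specialize (Hk (smooth_ex_filterdiff (E := C2R) nonzero _ _ HV Hsn)).
  apply is_derive_unique in Hk. rewrite <- Hk.
  replace (Derive _ 0) with
    (dirD (E := C2R) (fun x => Derive (fun r => l (radial (g r) x)) s) v w); [exact H|].
  refine (dirD_ext_loc (E := C2R) _
    (fun x => radial (fun x => l (V x)) (radial (g s) x)) v w _).
  apply locally_nonzero; [exact Hn|exact Hlp].
Qed.

Lemma is_deriveC_differential_flow (s : R) (v w : C2) : S3 w ->
  is_deriveC (fun r => fst (differential (g r) w v)) s
    (act (realvec (differential (g s) w v)) (fun x => fst (V x)) (g s w)) /\
  is_deriveC (fun r => snd (differential (g r) w v)) s
    (act (realvec (differential (g s) w v)) (fun x => snd (V x)) (g s w)).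
Proof.
  intros Hw. assert (Hsn : nonzero (g s w)) by now apply S3_nonzero, flow_S3.
  rewrite !act_realvec; [|apply smooth_fun_S3_V2|exact Hsn|apply smooth_fun_S3_V1|exact Hsn].
  destruct (cf_smooth _ _ g_flow) as [[G1 G2] [G3 G4]].
  destruct (vf_smooth _ V_field) as [[V1 V2] [V3 V4]].
  split; split.
  - exact (is_derive_dirD_flow _ s v w is_linear_fst_fst G1 V1 Hw).
  - exact (is_derive_dirD_flow _ s v w is_linear_snd_fst G2 V2 Hw).
  - exact (is_derive_dirD_flow _ s v w is_linear_fst_snd G3 V3 Hw).
  - exact (is_derive_dirD_flow _ s v w is_linear_snd_snd G4 V4 Hw).
Qed.

End Flow.

(** * Contact vector fields *)

(** The sphere equation with a single monomial on the left, the orientation in which [ring [HS]]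
    reduces modulo it. *)
Lemma S3_conj (w : C2) :
  S3 w -> (fst w * Cconj (fst w))%C = (1 - snd w * Cconj (snd w))%C.
Proof.
  unfold S3. rewrite !Cmod_sqr. intros H. destruct w as [[] []]. simpl in *.
  apply C_ext; simpl; lra.
Qed.

(** The real part of the Hermitian product of [w] and [v] is the radial component of [v], its
    imaginary part is the contact form. *)
Lemma tangent_eta (w v : C2) :
  tangent w v ->
  (Cconj (fst w) * fst v + Cconj (snd w) * snd v)%C = (Ci * RtoC (eta w v))%C.
Proof.
  unfold tangent, eta. intros H. destruct w as [[] []], v as [[] []]. simpl in *.
  apply C_ext; simpl; lra.
Qed.

(** For [w] on the sphere, w and (conj w2, - conj w1) form a unitary basis of C^2. The second
    coefficient [a] is the value of psi = w2 dw1 - w1 dw2 on [v]. *)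
Lemma tangent_decomp (w v : C2) : S3 w -> tangent w v ->
  let a := (fst v * snd w - snd v * fst w)%C in
  fst v = (Ci * RtoC (eta w v) * fst w + a * Cconj (snd w))%C /\
  snd v = (Ci * RtoC (eta w v) * snd w - a * Cconj (fst w))%C.
Proof.
  intros Hw Ht a. pose proof (S3_conj w Hw) as HS. rewrite <- tangent_eta by exact Ht.
  unfold a. split; ring [HS].
Qed.

Lemma tangent_hvec_of_eta (w v : C2) : S3 w -> tangent w v -> eta w v = 0 ->
  v = hvec (fst v * snd w - snd v * fst w)%C w.
Proof.
  intros Hw Ht He. destruct (tangent_decomp w v Hw Ht) as [H1 H2].
  rewrite He in H1, H2. apply injective_projections.
  - rewrite H1 at 1. unfold hvec, C2scal; simpl. ring.
  - rewrite H2 at 1. unfold hvec, C2scal; simpl. ring.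
Qed.

Lemma lie_conj_fst (w : C2) : S3 w ->
  lie W0 (fun x => Cconj (fst x)) w = RtoC 0 /\
  lie W0bar (fun x => Cconj (fst x)) w = snd w.
Proof.
  intros Hw. destruct (lie_fst w Hw) as [H1 H2].
  rewrite (lie_W0_conj (fun x => fst x)), (lie_W0bar_conj (fun x => fst x)), H1, H2.
  split; [|apply Cconj_conj]. apply C_ext; simpl; ring.
Qed.

Lemma lie_conj_snd (w : C2) : S3 w ->
  lie W0 (fun x => Cconj (snd x)) w = RtoC 0 /\
  lie W0bar (fun x => Cconj (snd x)) w = (- fst w)%C.
Proof.
  intros Hw. destruct (lie_snd w Hw) as [H1 H2].
  rewrite (lie_W0_conj (fun x => snd x)), (lie_W0bar_conj (fun x => snd x)), H1, H2.
  split; [apply C_ext; simpl; ring|]. now rewrite Copp_conj, Cconj_conj.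
Qed.

(** * S^1-invariant structures *)

(** With z = e^{i phi}, the rotation pushes [W0] to z^2 [W0] and [W0bar] to zbar^2 [W0bar]. Hence
    [W1bar nu w] goes to zbar^2 (W0bar - z^4 nu W0), and the quotient of the two factors is z^4. *)
Lemma S1_invariant_rot (nu : C2 -> C) (phi : R) (w : C2) :
  S1_invariant nu -> S3 w ->
  nu (rot phi w) =
  (let z := (cos phi, sin phi) : C in z * z * z * z * nu w)%C.
Proof.
  intros Hinv Hw. pose proof (S3_nonzero w Hw) as Hn.
  destruct (Hinv phi w (W1bar nu w) Hw) as [c Hc].
  { exists (RtoC 1). unfold ctscal, C2scal. destruct (W1bar nu w) as [[] []]. simpl.
    f_equal; f_equal; ring. }
  set (z := (cos phi, sin phi) : C). cbv zeta.
  assert (Hz : (z * Cconj z)%C = RtoC 1).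
  { pose proof (sin2_cos2 phi) as H. unfold Rsqr in H. apply C_ext; simpl; lra. }
  destruct (lie_fst w Hw) as [F1 F2]. destruct (lie_snd w Hw) as [G1 G2].
  destruct (lie_conj_fst w Hw) as [K1 K2]. destruct (lie_conj_snd w Hw) as [L1 L2].
  pose proof smooth_fun_S3_fst as Sf. pose proof smooth_fun_S3_snd as Ss.
  pose proof (smooth_fun_S3_conj _ Sf) as Scf. pose proof (smooth_fun_S3_conj _ Ss) as Scs.
  assert (Hact : forall f, act (W1bar nu w) f w = (lie W0bar f w - nu w * lie W0 f w)%C).
  { intros f. unfold W1bar. rewrite act_sub, act_scal. reflexivity. }
  pose proof (f_equal (fun X => fst (dw_part X)) Hc) as H1.
  pose proof (f_equal (fun X => snd (dw_part X)) Hc) as H2.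
  pose proof (f_equal (fun X => fst (dwbar_part X)) Hc) as H3.
  pose proof (f_equal (fun X => snd (dwbar_part X)) Hc) as H4.
  unfold pushforward in H1, H2, H3, H4.
  cbn [fst snd dw_part dwbar_part] in H1, H2, H3, H4.
  rewrite (act_ext _ _ (fun x => z * fst x)%C) in H1; [|reflexivity|exact Hn].
  rewrite (act_ext _ _ (fun x => z * snd x)%C) in H2; [|reflexivity|exact Hn].
  rewrite (act_ext _ _ (fun x => Cconj z * Cconj (fst x))%C) in H3;
    [|intros x _; apply Cmult_conj|exact Hn].
  rewrite (act_ext _ _ (fun x => Cconj z * Cconj (snd x))%C) in H4;
    [|intros x _; apply Cmult_conj|exact Hn].
  rewrite (act_scal_fun _ z (fun x => fst x)), Hact in H1 by assumption.
  rewrite (act_scal_fun _ z (fun x => snd x)), Hact in H2 by assumption.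
  rewrite (act_scal_fun _ (Cconj z) (fun x => Cconj (fst x))), Hact in H3 by assumption.
  rewrite (act_scal_fun _ (Cconj z) (fun x => Cconj (snd x))), Hact in H4 by assumption.
  rewrite F1, F2 in H1. rewrite G1, G2 in H2. rewrite K1, K2 in H3. rewrite L1, L2 in H4.
  cbn [W1bar ctsub ctadd ctscal C2add C2scal W0 W0bar fst snd rot
    dw_part dwbar_part] in H1, H2, H3, H4. fold z in H1, H2, H3, H4.
  pose proof (S3_conj w Hw) as HS.
  rewrite !Cmult_conj in *.
  set (nu' := nu (rot phi w)) in *. set (n := nu w) in *.
  set (w1 := fst w) in *. set (w2 := snd w) in *.
  (* Contracting the (1,0) components with psi, up to sign, isolates the coefficient of [W0]; in
     [E2] the (0,1) components are contracted with psibar, which yields c = zbar^2. *)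
  assert (E1 : (z * n = c * nu' * Cconj z)%C).
  { transitivity (- (z * (0 - n * Cconj w2)) * w2 + z * (0 - n * - Cconj w1) * w1)%C.
    - ring [HS].
    - rewrite H1, H2. ring [HS]. }
  assert (E2 : (Cconj z = c * z)%C).
  { transitivity ((Cconj z * (w2 - n * 0)) * Cconj w2
      - (Cconj z * (- w1 - n * 0)) * Cconj w1)%C.
    - ring [HS].
    - rewrite H3, H4. ring [HS]. }
  symmetry. transitivity (z * z * z * (z * n))%C; [ring|].
  rewrite E1. transitivity ((z * Cconj z) * (z * (c * z)) * nu')%C; [ring|].
  rewrite <- E2, Hz. ring.
Qed.

Lemma is_deriveC_cis : is_deriveC (fun phi => (cos phi, sin phi)) 0 Ci.
Proof.
  split; simpl.
  - replace 0 with (- sin 0) at 2 by (rewrite sin_0; ring). apply is_derive_cos.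
  - rewrite <- cos_0. apply is_derive_sin.
Qed.

Lemma is_deriveC_rot (w : C2) :
  is_derive (K := R_AbsRing) (V := C2R) (fun phi => rot phi w) 0 (C2scal Ci w).
Proof.
  pose proof is_deriveC_cis as Hz.
  apply is_derive_C2R; unfold rot, C2scal; simpl.
  - pose proof (is_deriveC_mult _ _ _ _ _ Hz (is_deriveC_const (fst w) 0)) as H.
    cbv beta in H. rewrite Cmult_0_r, Cplus_0_r in H. exact H.
  - pose proof (is_deriveC_mult _ _ _ _ _ Hz (is_deriveC_const (snd w) 0)) as H.
    cbv beta in H. rewrite Cmult_0_r, Cplus_0_r in H. exact H.
Qed.

Lemma rot_0 (w : C2) : rot 0 w = w.
Proof.
  unfold rot, C2scal. rewrite cos_0, sin_0. destruct w as [w1 w2]; simpl.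
  change (1, 0) with (RtoC 1). f_equal; ring.
Qed.

Lemma S3_rot (phi : R) (w : C2) : S3 w -> S3 (rot phi w).
Proof.
  unfold S3. rewrite !Cmod_sqr. intros H. pose proof (sin2_cos2 phi) as Hp.
  unfold Rsqr in Hp. unfold rot, C2scal. destruct w as [[a b] [c d]]. simpl in *.
  set (C := cos phi) in *. set (S := sin phi) in *.
  transitivity ((S * S + C * C) * (a * (a * 1) + b * (b * 1) + (c * (c * 1) + d * (d * 1))));
    [ring|]. rewrite H, Hp. ring.
Qed.

(** The vector i w generates the circle action, and 4i is the derivative of z^4 = e^{4i phi} at phi
    = 0. *)
Lemma S1_invariant_infinitesimal (nu : C2 -> C) (w : C2) :
  smooth_fun_S3 nu -> S1_invariant nu -> S3 w ->
  act (realvec (C2scal Ci w)) nu w = (4 * Ci * nu w)%C.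
Proof.
  intros Hnu Hinv Hw.
  pose proof (is_deriveC_S3_curve nu (fun phi => rot phi w) _ 0 Hnu
    (fun r => S3_rot r w Hw) (is_deriveC_rot w)) as H1.
  cbv beta in H1. rewrite rot_0 in H1.
  pose proof is_deriveC_cis as Hz.
  pose proof (is_deriveC_mult _ _ _ _ _ (is_deriveC_mult _ _ _ _ _
    (is_deriveC_mult _ _ _ _ _ (is_deriveC_mult _ _ _ _ _ Hz Hz) Hz) Hz)
    (is_deriveC_const (nu w) 0)) as H2.
  pose proof (is_deriveC_ext _ (fun phi => nu (rot phi w)) 0 _
    (fun r => eq_sym (S1_invariant_rot nu r w Hinv Hw)) H2) as H3.
  rewrite (is_deriveC_unique _ _ _ _ H1 H3).
  rewrite cos_0, sin_0. change (1, 0) with (RtoC 1). ring.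
Qed.

(** * Contact flows and their Hamiltonians *)

Section ContactFlow.

Variables (V : C2 -> C2) (g : R -> C2 -> C2) (u : C2 -> R).
Hypothesis V_field : smooth_vector_field V.
Hypothesis g_flow : contact_flow V g.
Hypothesis u_ham : contact_hamiltonian V u.

Let uC : C2 -> C := fun w => RtoC (u w).

Let SV1 := smooth_fun_S3_V1 V V_field.
Let SV2 := smooth_fun_S3_V2 V V_field.

Lemma smooth_hamiltonian : smooth_fun_S3 uC.
Proof.
  pose (p := fun x : C2 => (fst x * Cconj (fst (V x)) + snd x * Cconj (snd (V x)))%C).
  assert (Sp : smooth_fun_S3 p).
  { apply smooth_fun_S3_plus.
    - apply (smooth_fun_S3_mult (fun x => fst x)); [apply smooth_fun_S3_fst|].
      now apply (smooth_fun_S3_conj (fun x => fst (V x))).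
    - apply (smooth_fun_S3_mult (fun x => snd x)); [apply smooth_fun_S3_snd|].
      now apply (smooth_fun_S3_conj (fun x => snd (V x))). }
  (* This is - Im p, that is [eta x (V x)], written with operations already known to preserve
     smoothness. *)
  apply (smooth_fun_S3_ext (fun x => (Ci / 2) * (p x - Cconj (p x)))%C).
  - intros x Hx. unfold uC. rewrite (u_ham x Hx). unfold eta. fold (p x).
    destruct (p x). apply C_ext; simpl; field.
  - apply (smooth_fun_S3_mult (fun _ => Ci / 2)%C); [apply smooth_fun_S3_const|].
    apply smooth_fun_S3_minus; [exact Sp|now apply smooth_fun_S3_conj].
Qed.

(** The value of psi on [V], i.e. the coefficient of [W0] in the horizontal part of [V]. *)
Definition hcoef (w : C2) : C := (fst (V w) * snd w - snd (V w) * fst w)%C.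

Lemma smooth_hcoef : smooth_fun_S3 hcoef.
Proof.
  apply (smooth_fun_S3_minus (fun w => fst (V w) * snd w)%C (fun w => snd (V w) * fst w)%C).
  - apply (smooth_fun_S3_mult (fun w => fst (V w)) (fun w => snd w)); [exact SV1|apply smooth_fun_S3_snd].
  - apply (smooth_fun_S3_mult (fun w => snd (V w)) (fun w => fst w)); [exact SV2|apply smooth_fun_S3_fst].
Qed.

Lemma V_decomp (w : C2) : S3 w ->
  fst (V w) = (Ci * uC w * fst w + hcoef w * Cconj (snd w))%C /\
  snd (V w) = (Ci * uC w * snd w - hcoef w * Cconj (fst w))%C.
Proof.
  intros Hw. unfold uC. rewrite (u_ham w Hw).
  apply tangent_decomp; [exact Hw|]. now apply (vf_tangent _ V_field).
Qed.

Lemma act_V1 (X : ctvec) (w : C2) : S3 w ->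
  act X (fun x => fst (V x)) w =
  (Ci * (act X uC w * fst w + uC w * act X (fun x => fst x) w)
   + (act X hcoef w * Cconj (snd w) + hcoef w * act X (fun x => Cconj (snd x)) w))%C.
Proof.
  intros Hw. pose proof smooth_hamiltonian as Su. pose proof smooth_hcoef as Sa.
  pose proof smooth_fun_S3_fst as Sf.
  pose proof (smooth_fun_S3_conj _ smooth_fun_S3_snd) as Scs.
  pose proof (smooth_fun_S3_mult _ _ Su Sf) as S1.
  pose proof (smooth_fun_S3_mult _ _ (smooth_fun_S3_const Ci) S1) as S2.
  pose proof (smooth_fun_S3_mult _ _ Sa Scs) as S3'.
  pose proof (S3_nonzero w Hw) as Hn.
  rewrite (act_ext X _ (fun x => Ci * (uC x * fst x) + hcoef x * Cconj (snd x))%C);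
    [|intros x Hx; rewrite (proj1 (V_decomp x Hx)); ring|exact Hn].
  rewrite (act_plus X (fun x => Ci * (uC x * fst x))%C (fun x => hcoef x * Cconj (snd x))%C)
    by assumption.
  rewrite (act_scal_fun X Ci (fun x => uC x * fst x)%C) by assumption.
  rewrite (act_mult X uC (fun x => fst x)) by assumption.
  now rewrite (act_mult X hcoef (fun x => Cconj (snd x))) by assumption.
Qed.

Lemma act_V2 (X : ctvec) (w : C2) : S3 w ->
  act X (fun x => snd (V x)) w =
  (Ci * (act X uC w * snd w + uC w * act X (fun x => snd x) w)
   - (act X hcoef w * Cconj (fst w) + hcoef w * act X (fun x => Cconj (fst x)) w))%C.
Proof.
  intros Hw. pose proof smooth_hamiltonian as Su. pose proof smooth_hcoef as Sa.
  pose proof smooth_fun_S3_snd as Ss.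
  pose proof (smooth_fun_S3_conj _ smooth_fun_S3_fst) as Scf.
  pose proof (smooth_fun_S3_mult _ _ Su Ss) as S1.
  pose proof (smooth_fun_S3_mult _ _ (smooth_fun_S3_const Ci) S1) as S2.
  pose proof (smooth_fun_S3_mult _ _ Sa Scf) as S3'.
  pose proof (S3_nonzero w Hw) as Hn.
  rewrite (act_ext X _ (fun x => Ci * (uC x * snd x) - hcoef x * Cconj (fst x))%C);
    [|intros x Hx; rewrite (proj2 (V_decomp x Hx)); ring|exact Hn].
  rewrite (act_minus X (fun x => Ci * (uC x * snd x))%C (fun x => hcoef x * Cconj (fst x))%C)
    by assumption.
  rewrite (act_scal_fun X Ci (fun x => uC x * snd x)%C) by assumption.
  rewrite (act_mult X uC (fun x => snd x)) by assumption.
  now rewrite (act_mult X hcoef (fun x => Cconj (fst x))) by assumption.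
Qed.

(** * The differential of the flow on the contact planes *)

Lemma flow_tangent (s : R) (v w : C2) :
  S3 w -> tangent (g s w) (differential (g s) w v).
Proof.
  intros Hw. pose proof (S3_nonzero w Hw) as Hn.
  pose proof (smooth_fun_S3_g1 V g g_flow s) as S1.
  pose proof (smooth_fun_S3_g2 V g g_flow s) as S2.
  pose proof (smooth_fun_S3_conj _ S1) as S1c. pose proof (smooth_fun_S3_conj _ S2) as S2c.
  (* The constant |g_s|^2 = 1 is differentiated along [v]. That the two functions agree on the
     sphere stays a premise of [E] and is discharged last. *)
  pose proof (act_ext (realvec v)
    (fun x => fst (g s x) * Cconj (fst (g s x)) + snd (g s x) * Cconj (snd (g s x)))%C
    (fun _ => RtoC 1) w) as E.
  rewrite act_const in E.
  rewrite (act_plus _ (fun x => fst (g s x) * Cconj (fst (g s x)))%C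
    (fun x => snd (g s x) * Cconj (snd (g s x)))%C) in E;
    [|now apply smooth_fun_S3_mult|now apply smooth_fun_S3_mult|exact Hn].
  rewrite (act_mult _ (fun x => fst (g s x)) (fun x => Cconj (fst (g s x)))) in E by assumption.
  rewrite (act_mult _ (fun x => snd (g s x)) (fun x => Cconj (snd (g s x)))) in E by assumption.
  rewrite !act_realvec in E by assumption.
  change (dirDC (radial (fun x => Cconj (fst (g s x)))) v w)
    with (dirDC (fun x => Cconj (radial (fun x => fst (g s x)) x)) v w) in E.
  change (dirDC (radial (fun x => Cconj (snd (g s x)))) v w)
    with (dirDC (fun x => Cconj (radial (fun x => snd (g s x)) x)) v w) in E.
  rewrite !dirDC_conj in E.
  change (dirDC (radial (fun x => fst (g s x))) v w) with (fst (differential (g s) w v)) in E.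
  change (dirDC (radial (fun x => snd (g s x))) v w) with (snd (differential (g s) w v)) in E.
  assert (E' := fun H => f_equal Re (E H Hn)). clear E.
  unfold tangent.
  destruct (g s w) as [[] []], (differential (g s) w v) as [[] []]. simpl in *.
  cut (2 * (r * r3 - - r0 * r4 + (r1 * r5 - - r2 * r6)) = 0); [lra|].
  rewrite <- E'; [ring|].
  intros x Hx. rewrite S3_conj by now apply (flow_S3 V g g_flow). ring.
Qed.

(** Tangency is needed because [differential] is taken of the radial extension, which annihilates
    the normal direction even for the identity map. *)
Lemma differential_flow_0 (v w : C2) :
  S3 w -> tangent w v -> differential (g 0) w v = v.
Proof.
  intros Hw Ht. pose proof (S3_nonzero w Hw) as Hn.
  apply injective_projections.
  - transitivity (dirDC (radial (fun x => fst x)) v w); [|now apply dirDC_radial_fst].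
    apply (dirDC_radial_ext (fun x => fst (g 0 x)) (fun x => fst x)); [|exact Hn].
    intros x Hx. now rewrite (cf_id _ _ g_flow).
  - transitivity (dirDC (radial (fun x => snd x)) v w); [|now apply dirDC_radial_snd].
    apply (dirDC_radial_ext (fun x => snd (g 0 x)) (fun x => snd x)); [|exact Hn].
    intros x Hx. now rewrite (cf_id _ _ g_flow).
Qed.

(** The value of g_s^* psi on the real contact vector [hvec c w]. Since the contact planes are
    preserved, it determines the image vector completely. *)
Definition kappa (c : C) (w : C2) (s : R) : C :=
  (fst (differential (g s) w (hvec c w)) * snd (g s w)
   - snd (differential (g s) w (hvec c w)) * fst (g s w))%C.

Lemma differential_hvec (c : C) (w : C2) (s : R) : S3 w ->
  differential (g s) w (hvec c w) = hvec (kappa c w s) (g s w).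
Proof.
  intros Hw. apply tangent_hvec_of_eta.
  - now apply (flow_S3 V g g_flow).
  - now apply flow_tangent.
  - apply (ct_contact _ (cf_contact _ _ g_flow s) w (hvec c w) Hw (tangent_hvec c w)).
    apply eta_hvec.
Qed.

Lemma conj_dot_hvec (c : C) (w : C2) :
  (Cconj (fst w) * fst (hvec c w) + Cconj (snd w) * snd (hvec c w))%C = RtoC 0.
Proof. unfold hvec, C2scal; simpl. ring. Qed.

(* The Hamiltonian determines the horizontal part of the vector field: this is the
   first-order term of the invariance of the contact planes. *)
Lemma hcoef_eq (w : C2) : S3 w -> hcoef w = (Ci * lie W0bar uC w)%C.
Proof.
  intros Hw.
  (* The image of a contact vector stays Hermitian-orthogonal to the base point [g r w]; this is the
     derivative at time 0 of that vanishing product. *)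
  assert (H0 : forall c : C,
    (Cconj (fst (V w)) * fst (hvec c w)
      + Cconj (fst w) * act (realvec (hvec c w)) (fun x => fst (V x)) w
     + (Cconj (snd (V w)) * snd (hvec c w)
      + Cconj (snd w) * act (realvec (hvec c w)) (fun x => snd (V x)) w))%C = RtoC 0).
  { intros c.
    destruct (is_derive_C2R_inv _ _ _ (cf_generated _ _ g_flow 0 w Hw)) as [F1 F2].
    destruct (is_deriveC_differential_flow V g V_field g_flow 0 (hvec c w) w Hw) as [P1 P2].
    pose proof (is_deriveC_plus _ _ _ _ _
      (is_deriveC_mult _ _ _ _ _ (is_deriveC_conj _ _ _ F1) P1)
      (is_deriveC_mult _ _ _ _ _ (is_deriveC_conj _ _ _ F2) P2)) as D.
    apply (is_deriveC_ext _ (fun _ => RtoC 0)) in D.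
    - pose proof (is_deriveC_unique _ _ _ _ D (is_deriveC_const (RtoC 0) 0)) as E.
      rewrite (differential_flow_0 _ w Hw (tangent_hvec c w)) in E.
      rewrite (cf_id _ _ g_flow w Hw) in E. exact E.
    - intros r. rewrite differential_hvec by exact Hw. apply conj_dot_hvec. }
  (* The coefficient of cbar in [H0]. After inserting the decomposition of [V], the derivatives of
     [hcoef] cancel and i Zbar u - [hcoef] remains. *)
  assert (H1 : (Cconj (fst w) * lie W0bar (fun x => fst (V x)) w
              + Cconj (snd w) * lie W0bar (fun x => snd (V x)) w)%C = RtoC 0).
  { apply (conj_linear_eq
      (Cconj (fst (V w)) * Cconj (snd w) - Cconj (snd (V w)) * Cconj (fst w)
       + Cconj (fst w) * lie W0 (fun x => fst (V x)) w
       + Cconj (snd w) * lie W0 (fun x => snd (V x)) w)%C _ (RtoC 0) (RtoC 0)).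
    intros c. specialize (H0 c). rewrite !act_hvec in H0.
    transitivity (RtoC 0); [|ring]. rewrite <- H0.
    unfold hvec, C2scal; simpl. ring. }
  destruct (lie_fst w Hw) as [_ E1]. destruct (lie_snd w Hw) as [_ E2].
  destruct (lie_conj_fst w Hw) as [_ E3]. destruct (lie_conj_snd w Hw) as [_ E4].
  unfold lie in *. rewrite act_V1, act_V2 in H1 by exact Hw.
  rewrite E1, E2, E3, E4 in H1. pose proof (S3_conj w Hw) as HS.
  transitivity (Ci * act (W0bar w) uC w - RtoC 0)%C; [|ring].
  rewrite <- H1. ring [HS].
Qed.

Definition alpha (w : C2) : C :=
  (2 * Ci * uC w + Ci * lie W0 (lie W0bar uC) w)%C.

Definition beta (w : C2) : C := (Ci * lie W0bar (lie W0bar uC) w)%C.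

Lemma smooth_alpha : smooth_fun_S3 alpha.
Proof.
  pose proof smooth_hamiltonian as Su.
  apply (smooth_fun_S3_plus (fun w => 2 * Ci * uC w)%C
    (fun w => Ci * lie W0 (lie W0bar uC) w)%C).
  - apply (smooth_fun_S3_mult (fun _ => 2 * Ci)%C uC); [apply smooth_fun_S3_const|exact Su].
  - apply (smooth_fun_S3_mult (fun _ => Ci)); [apply smooth_fun_S3_const|].
    now apply smooth_fun_S3_lie_W0, smooth_fun_S3_lie_W0bar.
Qed.

Lemma smooth_beta : smooth_fun_S3 beta.
Proof.
  apply (smooth_fun_S3_mult (fun _ => Ci)); [apply smooth_fun_S3_const|].
  apply smooth_fun_S3_lie_W0bar, smooth_fun_S3_lie_W0bar, smooth_hamiltonian.
Qed.

Lemma act_hcoef (X : ctvec) (w : C2) : S3 w ->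
  act X hcoef w = (Ci * act X (lie W0bar uC) w)%C.
Proof.
  intros Hw. rewrite (act_ext X hcoef (fun x => Ci * lie W0bar uC x)%C).
  - apply act_scal_fun; [|exact Hw]. apply smooth_fun_S3_lie_W0bar, smooth_hamiltonian.
  - exact hcoef_eq.
  - now apply S3_nonzero.
Qed.

(** The components of dV along [W0] and [W0bar], paired with psi at a fixed base point. The missing
    i u in the first one is supplied when psi itself moves with the flow. *)
Lemma lie_V (w : C2) : S3 w ->
  (lie W0 (fun x => fst (V x)) w * snd w - lie W0 (fun x => snd (V x)) w * fst w
   = alpha w - Ci * uC w)%C /\
  (lie W0bar (fun x => fst (V x)) w * snd w - lie W0bar (fun x => snd (V x)) w * fst w
   = beta w)%C.
Proof.
  intros Hw. pose proof (S3_conj w Hw) as HS.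
  destruct (lie_fst w Hw) as [F1 F2]. destruct (lie_snd w Hw) as [G1 G2].
  destruct (lie_conj_fst w Hw) as [K1 K2]. destruct (lie_conj_snd w Hw) as [L1 L2].
  unfold alpha, beta, lie in *. rewrite !act_V1, !act_V2, !act_hcoef by exact Hw.
  rewrite F1, F2, G1, G2, K1, K2, L1, L2. unfold lie.
  split; ring [HS].
Qed.

(** Product rule for psi paired with the moving vector: dV contributes through [lie_V], and the
    moving coefficients of psi contribute the Hermitian product of base point and [V], which is i u,
    times [kappa]. *)
Lemma is_deriveC_kappa (c : C) (w : C2) (s : R) : S3 w ->
  is_deriveC (kappa c w) s
    (alpha (g s w) * kappa c w s + beta (g s w) * Cconj (kappa c w s))%C.
Proof.
  intros Hw. assert (Hs : S3 (g s w)) by now apply (flow_S3 V g g_flow).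
  destruct (is_derive_C2R_inv _ _ _ (cf_generated _ _ g_flow s w Hw)) as [F1 F2].
  destruct (is_deriveC_differential_flow V g V_field g_flow s (hvec c w) w Hw) as [P1 P2].
  pose proof (is_deriveC_minus _ _ _ _ _ (is_deriveC_mult _ _ _ _ _ P1 F2)
    (is_deriveC_mult _ _ _ _ _ P2 F1)) as D.
  cbv beta in D. rewrite (differential_hvec c w s Hw), !act_hvec in D.
  destruct (lie_V _ Hs) as [E1 E2]. destruct (V_decomp _ Hs) as [V1 V2].
  pose proof (S3_conj _ Hs) as HS.
  unfold kappa at 1. eapply eq_ind; [exact D|].
  set (k := kappa c w s). rewrite V1, V2, <- E2.
  replace (alpha (g s w)) with (Ci * uC (g s w)
    + (lie W0 (fun x => fst (V x)) (g s w) * snd (g s w)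
       - lie W0 (fun x => snd (V x)) (g s w) * fst (g s w)))%C by (rewrite E1; ring).
  unfold hvec, C2scal; simpl. ring [HS].
Qed.

(** The values of g_s^* psi on [W0] and, for [coefB], on [W0bar]. *)
Definition coefA (w : C2) (s : R) : C :=
  (lie W0 (fun x => fst (g s x)) w * snd (g s w)
   - lie W0 (fun x => snd (g s x)) w * fst (g s w))%C.

Definition coefB (w : C2) (s : R) : C :=
  (lie W0bar (fun x => fst (g s x)) w * snd (g s w)
   - lie W0bar (fun x => snd (g s x)) w * fst (g s w))%C.

Lemma kappa_coef (c : C) (w : C2) (s : R) : S3 w ->
  kappa c w s = (c * coefA w s + Cconj c * coefB w s)%C.
Proof.
  intros Hw. pose proof (S3_nonzero w Hw) as Hn. unfold kappa, coefA, coefB.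
  change (fst (differential (g s) w (hvec c w)))
    with (dirDC (radial (fun x => fst (g s x))) (hvec c w) w).
  change (snd (differential (g s) w (hvec c w)))
    with (dirDC (radial (fun x => snd (g s x))) (hvec c w) w).
  rewrite <- !act_realvec by
    first [apply (smooth_fun_S3_g1 V g g_flow) | apply (smooth_fun_S3_g2 V g g_flow) | exact Hn].
  rewrite !act_hvec. ring.
Qed.

Lemma coef_0 (w : C2) : S3 w -> coefA w 0 = RtoC 1 /\ coefB w 0 = RtoC 0.
Proof.
  intros Hw. apply conj_linear_eq. intros c. rewrite <- kappa_coef by exact Hw.
  unfold kappa. rewrite (differential_flow_0 _ w Hw (tangent_hvec c w)).
  rewrite (cf_id _ _ g_flow w Hw). pose proof (S3_conj w Hw) as HS.
  unfold hvec, C2scal; simpl. ring [HS].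
Qed.

(** A = (kappa(1) - i kappa(i)) / 2 and B = (kappa(1) + i kappa(i)) / 2. The conjugate in the
    equation for [kappa] exchanges the linear and antilinear parts, whence the cross-coupling. *)
Lemma is_deriveC_coef (w : C2) (s : R) : S3 w ->
  is_deriveC (coefA w) s
    (alpha (g s w) * coefA w s + beta (g s w) * Cconj (coefB w s))%C /\
  is_deriveC (coefB w) s
    (alpha (g s w) * coefB w s + beta (g s w) * Cconj (coefA w s))%C.
Proof.
  intros Hw.
  pose proof (is_deriveC_kappa (RtoC 1) w s Hw) as D1.
  pose proof (is_deriveC_mult _ _ _ _ _ (is_deriveC_const Ci s)
    (is_deriveC_kappa Ci w s Hw)) as Di.
  cbv beta in D1, Di.
  pose proof (is_deriveC_mult _ _ _ _ _ (is_deriveC_const (/ 2)%C s)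
    (is_deriveC_minus _ _ _ _ _ D1 Di)) as DA.
  pose proof (is_deriveC_mult _ _ _ _ _ (is_deriveC_const (/ 2)%C s)
    (is_deriveC_plus _ _ _ _ _ D1 Di)) as DB.
  cbv beta in DA, DB. rewrite !(kappa_coef _ w s Hw) in DA, DB.
  split.
  - apply is_deriveC_ext with (g := coefA w) in DA.
    + eapply eq_ind; [exact DA|].
      destruct (coefA w s), (coefB w s), (alpha (g s w)), (beta (g s w)).
      apply C_ext; simpl; field.
    + intros r. rewrite !(kappa_coef _ w r Hw).
      destruct (coefA w r), (coefB w r). apply C_ext; simpl; field.
  - apply is_deriveC_ext with (g := coefB w) in DB.
    + eapply eq_ind; [exact DB|].
      destruct (coefA w s), (coefB w s), (alpha (g s w)), (beta (g s w)).
      apply C_ext; simpl; field.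
    + intros r. rewrite !(kappa_coef _ w r Hw).
      destruct (coefA w r), (coefB w r). apply C_ext; simpl; field.
Qed.

Lemma Cminus_diag_uniq (a b : C) : (a - b)%C = RtoC 0 -> a = b.
Proof. intros H. transitivity (a - b + b)%C; [ring|]. rewrite H. ring. Qed.

(** psi vanishes on (0,1) vectors of the standard structure. The result is left without division,
    since A - nubar B is known to be nonzero only for small s. *)
Lemma beltrami_coef (nu : C2 -> C) (m : C2 -> C) (s : R) (w : C2) :
  is_beltrami nu (g s) m -> S3 w ->
  (coefB w s - nu w * coefA w s)%C = (m w * (coefA w s - Cconj (nu w) * coefB w s))%C.
Proof.
  intros Hb Hw. destruct (Hb w Hw) as [c Hc].
  pose proof (f_equal (fun X => fst (dw_part X)) Hc) as H1.
  pose proof (f_equal (fun X => snd (dw_part X)) Hc) as H2.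
  unfold pushforward in H1, H2.
  cbn [fst snd dw_part] in H1, H2.
  unfold W1bar, W1 in H1, H2.
  rewrite !act_sub, !act_scal, !act_sub, !act_scal in H1, H2.
  cbn [W1bar ctsub ctadd ctscal C2add C2scal W0 W0bar fst snd dw_part dwbar_part] in H1, H2.
  unfold nu_std in H1, H2. unfold coefA, coefB, lie.
  set (x1 := act (W0 w) (fun x => fst (g s x)) w) in *.
  set (x2 := act (W0 w) (fun x => snd (g s x)) w) in *.
  set (y1 := act (W0bar w) (fun x => fst (g s x)) w) in *.
  set (y2 := act (W0bar w) (fun x => snd (g s x)) w) in *.
  assert (E1 : (y1 - nu w * x1 = m w * (x1 - Cconj (nu w) * y1))%C).
  { apply Cminus_diag_uniq. rewrite H1. ring. }
  assert (E2 : (y2 - nu w * x2 = m w * (x2 - Cconj (nu w) * y2))%C).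
  { apply Cminus_diag_uniq. rewrite H2. ring. }
  transitivity ((y1 - nu w * x1) * snd (g s w) - (y2 - nu w * x2) * fst (g s w))%C; [ring|].
  rewrite E1, E2. ring.
Qed.

Lemma act_V (h : C2 -> C) (w : C2) : S3 w ->
  act (realvec (V w)) h w =
  (uC w * act (realvec (C2scal Ci w)) h w + Ci * lie W0bar uC w * lie W0 h w
   + Cconj (Ci * lie W0bar uC w) * lie W0bar h w)%C.
Proof.
  intros Hw. destruct (V_decomp w Hw) as [H1 H2]. rewrite (hcoef_eq w Hw) in H1, H2.
  assert (Hu : Cconj (uC w) = uC w) by (apply C_ext; simpl; ring).
  set (q := lie W0bar uC w) in *.
  unfold lie, act, realvec, C2conj, C2scal, W0, W0bar.
  cbn [fst snd dw_part dwbar_part]. rewrite H1, H2.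
  repeat rewrite ?Cplus_conj, ?Cminus_conj, ?Cmult_conj, ?Cconj_conj, ?Hu, ?Cconj_Ci.
  ring.
Qed.

End ContactFlow.

(** * Asymptotic expansions at 0 *)

(** The point s = 0 is included: order 0 is boundedness near 0, because [Rabs s ^ 0] is 1 there too,
    and any positive order forces [f 0] to vanish. *)
Definition bigO (n : nat) (f : R -> C) : Prop :=
  exists K d : R, 0 < d /\ forall s : R, Rabs s < d -> Cmod (f s) <= K * Rabs s ^ n.

Lemma bigO_ext (n : nat) (f g : R -> C) :
  (forall s, f s = g s) -> bigO n f -> bigO n g.
Proof.
  intros H (K & d & Hd & Hf). exists K, d. split; [exact Hd|].
  intros s Hs. rewrite <- H. now apply Hf.
Qed.

Lemma bigO_plus (n : nat) (f g : R -> C) :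
  bigO n f -> bigO n g -> bigO n (fun s => f s + g s)%C.
Proof.
  intros (K & d & Hd & Hf) (K' & d' & Hd' & Hg).
  exists (K + K'), (Rmin d d'). split; [now apply Rmin_pos|].
  intros s Hs. eapply Rle_trans; [apply Cmod_triangle|].
  specialize (Hf s (Rlt_le_trans _ _ _ Hs (Rmin_l _ _))).
  specialize (Hg s (Rlt_le_trans _ _ _ Hs (Rmin_r _ _))). lra.
Qed.

Lemma bigO_opp (n : nat) (f : R -> C) : bigO n f -> bigO n (fun s => - f s)%C.
Proof.
  intros (K & d & Hd & Hf). exists K, d. split; [exact Hd|].
  intros s Hs. rewrite Cmod_opp. now apply Hf.
Qed.

Lemma bigO_minus (n : nat) (f g : R -> C) :
  bigO n f -> bigO n g -> bigO n (fun s => f s - g s)%C.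
Proof. intros Hf Hg. apply bigO_plus; [|apply bigO_opp]; assumption. Qed.

Lemma bigO_conj (n : nat) (f : R -> C) : bigO n f -> bigO n (fun s => Cconj (f s)).
Proof.
  intros (K & d & Hd & Hf). exists K, d. split; [exact Hd|].
  intros s Hs. rewrite Cmod_conj. now apply Hf.
Qed.

Lemma bigO_weaken (n m : nat) (f : R -> C) : (m <= n)%nat -> bigO n f -> bigO m f.
Proof.
  intros Hnm (K & d & Hd & Hf). exists (Rabs K), (Rmin d 1).
  split; [apply Rmin_pos; lra|]. intros s Hs.
  specialize (Hf s (Rlt_le_trans _ _ _ Hs (Rmin_l _ _))).
  pose proof (Rlt_le_trans _ _ _ Hs (Rmin_r _ _)) as H1.
  pose proof (Rabs_pos s) as H0.
  eapply Rle_trans; [exact Hf|]. replace n with (m + (n - m))%nat by lia.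
  rewrite pow_add. pose proof (pow_le _ m H0) as Hm. pose proof (pow_le _ (n - m) H0) as Hk.
  assert (Rabs s ^ (n - m) <= 1).
  { rewrite <- (pow1 (n - m)). apply pow_incr. lra. }
  pose proof (Rle_abs K) as HK. pose proof (Rabs_pos K) as HK0.
  apply Rle_trans with (Rabs K * (Rabs s ^ m * Rabs s ^ (n - m))).
  - apply Rmult_le_compat_r; [now apply Rmult_le_pos|exact HK].
  - apply Rmult_le_compat_l; [exact HK0|]. rewrite <- (Rmult_1_r (Rabs s ^ m)) at 2.
    now apply Rmult_le_compat_l.
Qed.

Lemma bigO_mult (k n m : nat) (f g : R -> C) : (k <= n + m)%nat ->
  bigO n f -> bigO m g -> bigO k (fun s => f s * g s)%C.
Proof.
  intros Hk (K & d & Hd & Hf) (K' & d' & Hd' & Hg). apply (bigO_weaken (n + m)); [exact Hk|].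
  exists (K * K'), (Rmin d d'). split; [now apply Rmin_pos|].
  intros s Hs. rewrite Cmod_mult, pow_add.
  specialize (Hf s (Rlt_le_trans _ _ _ Hs (Rmin_l _ _))).
  specialize (Hg s (Rlt_le_trans _ _ _ Hs (Rmin_r _ _))).
  replace (K * K' * (Rabs s ^ n * Rabs s ^ m)) with ((K * Rabs s ^ n) * (K' * Rabs s ^ m)) by ring.
  apply Rmult_le_compat; (assumption || apply Cmod_ge_0).
Qed.

Lemma bigO_const (c : C) : bigO 0 (fun _ => c).
Proof. exists (Cmod c), 1. split; [lra|]. intros s _. simpl. lra. Qed.

Lemma bigO_id : bigO 1 RtoC.
Proof.
  exists 1, 1. split; [lra|]. intros s _. rewrite Cmod_R. lra.
Qed.

Lemma Cmod_le_Re_Im (z : C) : Cmod z <= Rabs (Re z) + Rabs (Im z).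
Proof.
  apply Rsqr_incr_0_var.
  - rewrite !Rsqr_pow2, Cmod_sqr. pose proof (Rabs_pos (Re z)). pose proof (Rabs_pos (Im z)).
    rewrite <- (pow2_abs (Re z)), <- (pow2_abs (Im z)). nra.
  - pose proof (Rabs_pos (Re z)). pose proof (Rabs_pos (Im z)). lra.
Qed.

Lemma is_deriveC_bigO (f : R -> C) (l : C) : is_deriveC f 0 l -> bigO 0 f.
Proof.
  intros [Hr Hi].
  assert (L : forall h : R -> R, ex_derive h 0 ->
    exists d, 0 < d /\ forall s, Rabs s < d -> Rabs (h s) <= Rabs (h 0) + 1).
  { intros h Hh. apply ex_derive_continuous in Hh.
    destruct (proj1 (filterlim_locally _ _) Hh (mkposreal 1 Rlt_0_1)) as [d Hd].
    exists d. split; [apply cond_pos|]. intros s Hs.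
    assert (Hb : Rabs (h s - h 0) < 1).
    { apply (Hd s). unfold ball; simpl. unfold AbsRing_ball, abs, minus, plus, opp; simpl.
      now rewrite Ropp_0, Rplus_0_r. }
    replace (h s) with (h 0 + (h s - h 0)) by ring.
    eapply Rle_trans; [apply Rabs_triang|]. lra. }
  destruct (L (fun r => Re (f r)) (ex_intro _ _ Hr)) as (d1 & Hd1 & H1).
  destruct (L (fun r => Im (f r)) (ex_intro _ _ Hi)) as (d2 & Hd2 & H2).
  eexists (Rabs (Re (f 0)) + 1 + (Rabs (Im (f 0)) + 1)), (Rmin d1 d2).
  split; [now apply Rmin_pos|]. intros s Hs. simpl.
  specialize (H1 s (Rlt_le_trans _ _ _ Hs (Rmin_l _ _))).
  specialize (H2 s (Rlt_le_trans _ _ _ Hs (Rmin_r _ _))).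
  pose proof (Cmod_le_Re_Im (f s)). lra.
Qed.

(** Mean value inequality for real and imaginary parts, hence the factor 2. It plays the part of
    Taylor's formula: a remainder is estimated from the differential equation it satisfies. *)
Lemma bigO_integrate (n : nat) (f f' : R -> C) :
  (forall s, is_deriveC f s (f' s)) -> f 0 = RtoC 0 -> bigO n f' -> bigO (S n) f.
Proof.
  intros Hf H0 (K & d & Hd & Hb). exists (2 * Rabs K), d. split; [exact Hd|].
  intros s Hs.
  assert (L : forall t, Rabs (t - 0) <= Rabs (s - 0) -> Cmod (f' t) <= Rabs K * Rabs s ^ n).
  { intros t Ht. rewrite !Rminus_0_r in Ht.
    eapply Rle_trans; [apply Hb; lra|]. pose proof (Rabs_pos t).
    apply Rle_trans with (Rabs K * Rabs t ^ n).
    - apply Rmult_le_compat_r; [now apply pow_le|apply Rle_abs].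
    - apply Rmult_le_compat_l; [apply Rabs_pos|]. apply pow_incr. lra. }
  eapply Rle_trans; [apply Cmod_le_Re_Im|].
  pose proof (bounded_variation (fun r => Re (f r)) (fun r => Re (f' r))
    (Rabs K * Rabs s ^ n) 0 s
    (fun t Ht => conj (proj1 (Hf t)) (Rle_trans _ _ _ (Rle_trans _ _ _ (Rmax_l _ _)
       (Rmax_Cmod (f' t))) (L t Ht)))) as B1.
  pose proof (bounded_variation (fun r => Im (f r)) (fun r => Im (f' r))
    (Rabs K * Rabs s ^ n) 0 s
    (fun t Ht => conj (proj2 (Hf t)) (Rle_trans _ _ _ (Rle_trans _ _ _ (Rmax_r _ _)
       (Rmax_Cmod (f' t))) (L t Ht)))) as B2.
  cbv beta in B1, B2. rewrite H0 in B1, B2. simpl in B1, B2. rewrite !Rminus_0_r in B1, B2.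
  simpl. lra.
Qed.

Lemma is_deriveC_id (s : R) : is_deriveC RtoC s (RtoC 1).
Proof. split; [exact (is_derive_id s)|exact (is_derive_const 0 s)]. Qed.

Lemma is_deriveC_eq (f : R -> C) (t : R) (l l' : C) :
  is_deriveC f t l -> l = l' -> is_deriveC f t l'.
Proof. now intros H <-. Qed.

(** * Expansion of the solutions of the linear system for A and B *)

Section CoefficientExpansion.

Variables (a b A B : R -> C) (al be be' : C).
Hypothesis A_ode : forall s, is_deriveC A s (a s * A s + b s * Cconj (B s))%C.
Hypothesis B_ode : forall s, is_deriveC B s (a s * B s + b s * Cconj (A s))%C.
Hypothesis A_0 : A 0 = RtoC 1.
Hypothesis B_0 : B 0 = RtoC 0.
Hypothesis a_expansion : bigO 1 (fun s => a s - al)%C.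
Hypothesis b_expansion : bigO 2 (fun s => b s - be - be' * RtoC s)%C.

Lemma A_bounded : bigO 0 A.
Proof. exact (is_deriveC_bigO _ _ (A_ode 0)). Qed.

Lemma B_bounded : bigO 0 B.
Proof. exact (is_deriveC_bigO _ _ (B_ode 0)). Qed.

Lemma a_bounded : bigO 0 a.
Proof.
  apply bigO_ext with (fun s => (a s - al) + al)%C; [intros; ring|].
  apply bigO_plus; [|apply bigO_const]. now apply (bigO_weaken 1); [lia|].
Qed.

Lemma b_order1 : bigO 1 (fun s => b s - be)%C.
Proof.
  apply bigO_ext with (fun s => (b s - be - be' * RtoC s) + be' * RtoC s)%C; [intros; ring|].
  apply bigO_plus; [now apply (bigO_weaken 2); [lia|]|].
  apply (bigO_mult 1 0 1); [lia|apply bigO_const|exact bigO_id].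
Qed.

Lemma b_bounded : bigO 0 b.
Proof.
  apply bigO_ext with (fun s => (b s - be) + be)%C; [intros; ring|].
  apply bigO_plus; [|apply bigO_const]. now apply (bigO_weaken 1); [lia|apply b_order1].
Qed.

(** Start of a bootstrap: each remainder has a derivative, given by the system, that is controlled
    by the remainders one order lower. *)
Lemma A_order1 : bigO 1 (fun s => A s - 1)%C.
Proof.
  pose proof A_bounded. pose proof B_bounded. pose proof a_bounded. pose proof b_bounded.
  apply (bigO_integrate 0 _ (fun s => a s * A s + b s * Cconj (B s))%C).
  - intros s. eapply is_deriveC_eq;
      [exact (is_deriveC_minus _ _ _ _ _ (A_ode s) (is_deriveC_const (RtoC 1) s))|ring].
  - rewrite A_0. ring.
  - apply bigO_plus; apply (bigO_mult 0 0 0); auto. now apply bigO_conj.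
Qed.

Lemma B_order1 : bigO 1 B.
Proof.
  pose proof A_bounded. pose proof B_bounded. pose proof a_bounded. pose proof b_bounded.
  apply (bigO_integrate 0 _ _ B_ode B_0).
  apply bigO_plus; apply (bigO_mult 0 0 0); auto. now apply bigO_conj.
Qed.

Lemma A_order2 : bigO 2 (fun s => A s - 1 - al * RtoC s)%C.
Proof.
  apply (bigO_integrate 1 _ (fun s => (a s - al) * A s + al * (A s - 1)
           + b s * Cconj (B s))%C).
  - intros s. eapply is_deriveC_eq.
    + exact (is_deriveC_minus _ _ _ _ _
        (is_deriveC_minus _ _ _ _ _ (A_ode s) (is_deriveC_const (RtoC 1) s))
        (is_deriveC_mult _ _ _ _ _ (is_deriveC_const al s) (is_deriveC_id s))).
    + cbv beta. ring.
  - rewrite A_0. ring.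
  - apply bigO_plus; [apply bigO_plus|].
    + apply (bigO_mult 1 1 0); [lia|exact a_expansion|exact A_bounded].
    + apply (bigO_mult 1 0 1); [lia|apply bigO_const|exact A_order1].
    + apply (bigO_mult 1 0 1); [lia|exact b_bounded|apply bigO_conj, B_order1].
Qed.

Lemma A_conj_order1 : bigO 1 (fun s => Cconj (A s) - 1)%C.
Proof.
  apply bigO_ext with (fun s => Cconj (A s - 1))%C; [|apply bigO_conj, A_order1].
  intros s. rewrite Cminus_conj. f_equal. apply C_ext; simpl; ring.
Qed.

Lemma A_conj_order2 : bigO 2 (fun s => Cconj (A s) - 1 - Cconj al * RtoC s)%C.
Proof.
  apply bigO_ext with (fun s => Cconj (A s - 1 - al * RtoC s))%C;
    [|apply bigO_conj, A_order2].
  intros s. destruct (A s), al. apply C_ext; simpl; ring.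
Qed.

Lemma B_order2 : bigO 2 (fun s => B s - be * RtoC s)%C.
Proof.
  apply (bigO_integrate 1 _ (fun s => a s * B s + (b s - be) * Cconj (A s)
           + be * (Cconj (A s) - 1))%C).
  - intros s. eapply is_deriveC_eq.
    + exact (is_deriveC_minus _ _ _ _ _ (B_ode s)
        (is_deriveC_mult _ _ _ _ _ (is_deriveC_const be s) (is_deriveC_id s))).
    + cbv beta. ring.
  - rewrite B_0. ring.
  - apply bigO_plus; [apply bigO_plus|].
    + apply (bigO_mult 1 0 1); [lia|exact a_bounded|exact B_order1].
    + apply (bigO_mult 1 1 0); [lia|exact b_order1|apply bigO_conj, A_bounded].
    + apply (bigO_mult 1 0 1); [lia|apply bigO_const|exact A_conj_order1].
Qed.

(** Half the coefficient of s in a B + b Abar, as obtained from B = be s, Abar = 1 + conj(al) s and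
    b = be + be' s. *)
Let c2 : C := (/ 2 * (be' + al * be + be * Cconj al))%C.

Lemma B_order3 : bigO 3 (fun s => B s - be * RtoC s - c2 * (RtoC s * RtoC s))%C.
Proof.
  (* The derivative of the remainder regrouped into products of order 2; the last summand is the
     quadratic term left by multiplying the truncations of b and Abar. *)
  apply (bigO_integrate 2 _ (fun s => (a s - al) * B s + al * (B s - be * RtoC s)
     + (b s - be - be' * RtoC s) * Cconj (A s)
     + (be + be' * RtoC s) * (Cconj (A s) - 1 - Cconj al * RtoC s)
     + (be' * Cconj al) * (RtoC s * RtoC s))%C).
  - intros s. eapply is_deriveC_eq.
    + exact (is_deriveC_minus _ _ _ _ _ (is_deriveC_minus _ _ _ _ _ (B_ode s)
        (is_deriveC_mult _ _ _ _ _ (is_deriveC_const be s) (is_deriveC_id s)))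
        (is_deriveC_mult _ _ _ _ _ (is_deriveC_const c2 s)
          (is_deriveC_mult _ _ _ _ _ (is_deriveC_id s) (is_deriveC_id s)))).
    + cbv beta. unfold c2.
      destruct (a s), (b s), (A s), (B s), al, be, be'. apply C_ext; simpl; field.
  - rewrite B_0. ring.
  - apply bigO_plus; [apply bigO_plus; [apply bigO_plus; [apply bigO_plus|]|]|].
    + apply (bigO_mult 2 1 1); [lia|exact a_expansion|exact B_order1].
    + apply (bigO_mult 2 0 2); [lia|apply bigO_const|exact B_order2].
    + apply (bigO_mult 2 2 0); [lia|exact b_expansion|apply bigO_conj, A_bounded].
    + apply (bigO_mult 2 0 2); [lia| |exact A_conj_order2].
      apply bigO_plus; [apply bigO_const|].
      apply (bigO_mult 0 0 1); [lia|apply bigO_const|exact bigO_id].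
    + apply (bigO_mult 2 0 2); [lia|apply bigO_const|].
      apply (bigO_mult 2 1 1); [lia|exact bigO_id|exact bigO_id].
Qed.

(** The quadratic coefficient is c2 + be conj(al): of the three halves of be conj(al), one comes
    from [c2] and two from the first-order term of Abar. *)
Lemma BA_order3 :
  bigO 3 (fun s => B s * Cconj (A s) - be * RtoC s
    - / 2 * (be' + be * (al + 3 * Cconj al)) * (RtoC s * RtoC s))%C.
Proof.
  apply bigO_ext with (fun s =>
    (B s - be * RtoC s - c2 * (RtoC s * RtoC s)) * Cconj (A s)
    + be * (RtoC s * (Cconj (A s) - 1 - Cconj al * RtoC s))
    + c2 * ((RtoC s * RtoC s) * (Cconj (A s) - 1)))%C.
  - intros s. unfold c2.
    destruct (A s), (B s), al, be, be'. apply C_ext; simpl; field.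
  - apply bigO_plus; [apply bigO_plus|].
    + apply (bigO_mult 3 3 0); [lia|exact B_order3|apply bigO_conj, A_bounded].
    + apply (bigO_mult 3 0 3); [lia|apply bigO_const|].
      apply (bigO_mult 3 1 2); [lia|exact bigO_id|exact A_conj_order2].
    + apply (bigO_mult 3 0 3); [lia|apply bigO_const|].
      apply (bigO_mult 3 2 1); [lia| |exact A_conj_order1].
      apply (bigO_mult 2 1 1); [lia|exact bigO_id|exact bigO_id].
Qed.

Lemma BB_order3 :
  bigO 3 (fun s => B s * Cconj (B s) - be * Cconj be * (RtoC s * RtoC s))%C.
Proof.
  apply bigO_ext with (fun s => (B s - be * RtoC s) * Cconj (B s)
    + be * (RtoC s * Cconj (B s - be * RtoC s)))%C.
  - intros s. destruct (B s), be. apply C_ext; simpl; ring.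
  - apply bigO_plus.
    + apply (bigO_mult 3 2 1); [lia|exact B_order2|apply bigO_conj, B_order1].
    + apply (bigO_mult 3 0 3); [lia|apply bigO_const|].
      apply (bigO_mult 3 1 2); [lia|exact bigO_id|apply bigO_conj, B_order2].
Qed.

(** * The modulus of the Beltrami coefficient *)

Variables (nu : C) (m : R -> C).
Hypothesis nu_nonzero : nu <> RtoC 0.
Hypothesis m_eq : forall s, (B s - nu * A s = m s * (A s - Cconj nu * B s))%C.
Hypothesis first_order : Re (Cconj nu * be)%C = 0.

Let n : R := Cmod nu.
(** Normalized so that (n + k s^2)^2 has quadratic coefficient 2 n k, the one found for the squared
    modulus; this is the source of the denominator 2 |nu|. *)
Let k : R := (1 - n ^ 2) / (2 * n) *
  ((1 + n ^ 2) * Cmod be ^ 2 - Re (Cconj nu * (be' + be * (al + 3 * Cconj al)))%C).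

Lemma Cmod_nu_pos : 0 < n.
Proof. apply Cmod_gt_0, nu_nonzero. Qed.

Let D (s : R) : C := (A s - Cconj nu * B s)%C.

Lemma D_order1 : bigO 1 (fun s => RtoC (Cmod (D s) ^ 2 - 1)).
Proof.
  assert (H : bigO 1 (fun s => D s - 1)%C).
  { apply bigO_ext with (fun s => (A s - 1) - Cconj nu * B s)%C; [intros; unfold D; ring|].
    apply bigO_minus; [exact A_order1|].
    apply (bigO_mult 1 0 1); [lia|apply bigO_const|exact B_order1]. }
  apply bigO_ext with (fun s => (D s - 1) * Cconj (D s - 1) + (D s - 1) + Cconj (D s - 1))%C.
  - intros s. rewrite Cmod_sqr. destruct (D s). apply C_ext; simpl; ring.
  - apply bigO_plus; [apply bigO_plus|].
    + apply (bigO_mult 1 1 1); [lia|exact H|now apply bigO_conj].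
    + exact H.
    + now apply bigO_conj.
Qed.

(* [|B - nu A|^2 - |nu|^2 |A - nubar B|^2
      = (1 - |nu|^2) ((1 + |nu|^2) |B|^2 - 2 Re (nubar B Abar))]:
   the terms in [|A|^2] cancel, so [A] is only needed to first order. *)
Lemma numerator_order3 :
  bigO 3 (fun s => RtoC ((Cmod (m s) ^ 2 - n ^ 2) * Cmod (D s) ^ 2 - 2 * n * k * s ^ 2)).
Proof.
  pose proof Cmod_nu_pos as Hn.
  set (e := (/ 2 * (be' + be * (al + 3 * Cconj al)))%C).
  assert (H1 : bigO 3 (fun s => Cconj nu * (B s * Cconj (A s) - be * RtoC s
    - e * (RtoC s * RtoC s)))%C).
  { apply (bigO_mult 3 0 3); [lia|apply bigO_const|exact BA_order3]. }
  pose proof (bigO_plus _ _ _ H1 (bigO_conj _ _ H1)) as H2.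
  pose proof (bigO_mult 3 0 3 _ _ ltac:(lia) (bigO_const (RtoC (1 + n ^ 2))) BB_order3) as H3.
  pose proof (bigO_mult 3 0 3 _ _ ltac:(lia) (bigO_const (RtoC (1 - n ^ 2)))
    (bigO_minus _ _ _ H3 H2)) as H4.
  apply (bigO_ext 3) with (2 := H4). intros s. cbv beta.
  assert (HD : Cmod (m s) ^ 2 * Cmod (D s) ^ 2 = Cmod (B s - nu * A s)%C ^ 2).
  { rewrite m_eq. fold (D s). rewrite Cmod_mult. ring. }
  rewrite Rmult_minus_distr_r, HD.
  replace (2 * n * k) with ((1 - n ^ 2) * ((1 + n ^ 2) * Cmod be ^ 2
     - Re (Cconj nu * (be' + be * (al + 3 * Cconj al)))%C)) by (unfold k; field; lra).
  unfold n. unfold D. rewrite !Cmod_sqr. unfold e.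
  destruct nu as [n1 n2], (A s) as [a1 a2], (B s) as [b1 b2], al as [l1 l2],
    be as [p1 p2], be' as [q1 q2].
  simpl in first_order. assert (Hf : n1 * p1 = - (n2 * p2)) by lra.
  apply C_ext; simpl; [|field].
  apply Rminus_diag_uniq.
  (* The two sides differ only in the term linear in s, a multiple of Re (nubar be), which vanishes
     by [first_order]. *)
  transitivity ((1 - (n1 * n1 + n2 * n2)) * 2 * s * (n1 * p1 + n2 * p2)); [field|].
  rewrite Hf. ring.
Qed.

(** With M = |m| and q = n + k s^2, the bound on (M^2 - q^2) |D|^2 gives one on M - q, because (M +
    q) |D|^2 is at least n / 4 near 0. No square root has to be expanded. *)
Lemma modulus_expansion :
  bigO 3 (fun s => RtoC (Cmod (m s) - (n + k * s ^ 2))).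
Proof.
  pose proof Cmod_nu_pos as Hn.
  assert (H : bigO 3 (fun s => RtoC ((Cmod (m s) ^ 2 - (n + k * s ^ 2) ^ 2) * Cmod (D s) ^ 2))).
  (* Replacing n^2 + 2 n k s^2 by q^2, and multiplying by |D|^2 instead of 1, costs 2 n k s^2 (|D|^2
     - 1) and k^2 s^4 |D|^2, both of order at least 3. *)
  { apply bigO_ext with (fun s =>
      RtoC ((Cmod (m s) ^ 2 - n ^ 2) * Cmod (D s) ^ 2 - 2 * n * k * s ^ 2)
      - (RtoC (2 * n * k) * (RtoC s * RtoC s)) * RtoC (Cmod (D s) ^ 2 - 1)
      - (RtoC (k ^ 2) * (RtoC s * RtoC s)) * (RtoC s * RtoC s)
        * (RtoC (Cmod (D s) ^ 2 - 1) + 1))%C.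
    - intros s. apply C_ext; simpl; ring.
    - assert (H2 : bigO 2 (fun s => RtoC s * RtoC s)%C)
        by (apply (bigO_mult 2 1 1); [lia|exact bigO_id|exact bigO_id]).
      apply bigO_minus; [apply bigO_minus|].
      + exact numerator_order3.
      + apply (bigO_mult 3 2 1); [lia| |exact D_order1].
        apply (bigO_mult 2 0 2); [lia|apply bigO_const|exact H2].
      + apply (bigO_mult 3 4 0); [lia| |].
        * apply (bigO_mult 4 2 2); [lia| |exact H2].
          apply (bigO_mult 2 0 2); [lia|apply bigO_const|exact H2].
        * apply bigO_plus; [apply (bigO_weaken 1); [lia|exact D_order1]|apply bigO_const]. }
  destruct H as (K & d & Hd & HK). destruct D_order1 as (K1 & d1 & Hd1 & HK1).
  (* The second bound forces |D|^2 >= 1/2. The third, with s^2 <= |s| from the first, forces q >= n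
     / 2. *)
  set (r := Rmin 1 (Rmin (/ (2 * (Rabs K1 + 1))) (n / (2 * (Rabs k + 1))))).
  pose proof (Rabs_pos K1) as HK1p. pose proof (Rabs_pos k) as Hkp.
  pose proof (Rabs_pos K) as HKp.
  exists (4 * Rabs K / n), (Rmin r (Rmin d d1)). split.
  { repeat apply Rmin_pos; try assumption; try lra.
    - apply Rinv_0_lt_compat. lra.
    - apply Rdiv_lt_0_compat; lra. }
  intros s Hs.
  assert (Hs1 : Rabs s < 1 /\ Rabs s < / (2 * (Rabs K1 + 1)) /\
                Rabs s < n / (2 * (Rabs k + 1)) /\ Rabs s < d /\ Rabs s < d1).
  { unfold r in Hs. repeat apply Rmin_Rgt_l in Hs.
    destruct Hs as [Hs Hs']. apply Rmin_Rgt_l in Hs, Hs'.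
    destruct Hs as [? Hs]. apply Rmin_Rgt_l in Hs. tauto. }
  destruct Hs1 as (S1 & S2 & S3 & S4 & S5).
  specialize (HK s S4). specialize (HK1 s S5).
  rewrite Cmod_R in HK, HK1 |- *. rewrite pow_1 in HK1.
  pose proof (Rabs_pos s) as Hs0.
  assert (HD : / 2 <= Cmod (D s) ^ 2).
  { assert (K1 * Rabs s <= / 2).
    { apply Rle_trans with (Rabs K1 * Rabs s);
        [apply Rmult_le_compat_r; [exact Hs0|apply Rle_abs]|].
      apply Rle_trans with ((Rabs K1 + 1) * / (2 * (Rabs K1 + 1))).
      - apply Rmult_le_compat; lra.
      - right. field. lra. }
    apply Rabs_le_between in HK1. lra. }
  assert (Hk : n / 2 <= n + k * s ^ 2).
  { assert (Hks : Rabs (k * s ^ 2) <= n / 2).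
    { rewrite Rabs_mult, <- RPow_abs.
      apply Rle_trans with ((Rabs k + 1) * (n / (2 * (Rabs k + 1)))).
      - apply Rmult_le_compat; [lra|apply pow2_ge_0|lra|]. nra.
      - right. field. lra. }
    apply Rabs_le_between in Hks. lra. }
  pose proof (Cmod_ge_0 (m s)) as HM.
  set (M := Cmod (m s)) in *. set (q := n + k * s ^ 2) in *.
  set (DD := Cmod (D s) ^ 2) in *.
  (* n / 4 is the product of q >= n / 2 and |D|^2 >= 1/2, using M >= 0; its inverse is the 4 / n in
     the final constant. *)
  assert (HF : n / 4 * Rabs (M - q) <= Rabs ((M ^ 2 - q ^ 2) * DD)).
  { replace ((M ^ 2 - q ^ 2) * DD) with ((M - q) * ((M + q) * DD)) by ring.
    rewrite Rabs_mult, (Rabs_pos_eq ((M + q) * DD)) by nra.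
    rewrite Rmult_comm. apply Rmult_le_compat_l; [apply Rabs_pos|]. nra. }
  assert (HKs : K * Rabs s ^ 3 <= Rabs K * Rabs s ^ 3).
  { apply Rmult_le_compat_r; [now apply pow_le|apply Rle_abs]. }
  apply Rmult_le_reg_l with (n / 4); [lra|].
  replace (n / 4 * (4 * Rabs K / n * Rabs s ^ 3)) with (Rabs K * Rabs s ^ 3) by (field; lra).
  lra.
Qed.

End CoefficientExpansion.

(** * The second-order term *)

Section SecondOrder.

Variables (nu : C2 -> C) (V : C2 -> C2) (g : R -> C2 -> C2) (u : C2 -> R).
Hypothesis nu_smooth : smooth_fun_S3 nu.
Hypothesis nu_inv : S1_invariant nu.
Hypothesis V_field : smooth_vector_field V.
Hypothesis g_flow : contact_flow V g.
Hypothesis u_ham : contact_hamiltonian V u.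

Let uC : C2 -> C := fun w => RtoC (u w).
Let Q : C2 -> C := lie W0bar (lie W0bar uC).

Hypothesis u_nu : forall w, S3 w -> nu w <> RtoC 0 -> Im (Cconj (nu w) * Q w)%C = 0.

Definition lieV (h : C2 -> C) (w : C2) : C := act (realvec (V w)) h w.

Lemma Im_plus (a b : C) : Im (a + b)%C = Im a + Im b.
Proof. reflexivity. Qed.

Lemma smooth_lieV (h : C2 -> C) : smooth_fun_S3 h -> smooth_fun_S3 (lieV h).
Proof.
  intros Hh. pose proof (smooth_fun_S3_V1 V V_field) as S1.
  pose proof (smooth_fun_S3_V2 V V_field) as S2.
  apply smooth_fun_S3_act; [exact S1|exact S2| | |exact Hh].
  - exact (smooth_fun_S3_conj _ S1).
  - exact (smooth_fun_S3_conj _ S2).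
Qed.

Lemma is_deriveC_flow (h : C2 -> C) (s : R) (w : C2) :
  smooth_fun_S3 h -> S3 w -> is_deriveC (fun t => h (g t w)) s (lieV h (g s w)).
Proof. intros Hh Hw. now apply (is_deriveC_along_flow V g g_flow). Qed.

Lemma flow_bounded (h : C2 -> C) (w : C2) :
  smooth_fun_S3 h -> S3 w -> bigO 0 (fun s => h (g s w)).
Proof. intros Hh Hw. exact (is_deriveC_bigO _ _ (is_deriveC_flow h 0 w Hh Hw)). Qed.

Lemma flow_order1 (h : C2 -> C) (w : C2) :
  smooth_fun_S3 h -> S3 w -> bigO 1 (fun s => h (g s w) - h w)%C.
Proof.
  intros Hh Hw. apply (bigO_integrate 0 _ (fun s => lieV h (g s w))).
  - intros s. eapply is_deriveC_eq;
      [exact (is_deriveC_minus _ _ _ _ _ (is_deriveC_flow h s w Hh Hw)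
                (is_deriveC_const (h w) s))|ring].
  - rewrite (cf_id _ _ g_flow w Hw). ring.
  - apply flow_bounded; [now apply smooth_lieV|exact Hw].
Qed.

Lemma flow_order2 (h : C2 -> C) (w : C2) :
  smooth_fun_S3 h -> S3 w ->
  bigO 2 (fun s => h (g s w) - h w - lieV h w * RtoC s)%C.
Proof.
  intros Hh Hw. apply (bigO_integrate 1 _ (fun s => lieV h (g s w) - lieV h w)%C).
  - intros s. eapply is_deriveC_eq;
      [exact (is_deriveC_minus _ _ _ _ _
        (is_deriveC_minus _ _ _ _ _ (is_deriveC_flow h s w Hh Hw)
          (is_deriveC_const (h w) s))
        (is_deriveC_mult _ _ _ _ _ (is_deriveC_const (lieV h w) s) (is_deriveC_id s)))|].
    cbv beta. ring.
  - rewrite (cf_id _ _ g_flow w Hw). ring.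
  - apply flow_order1; [now apply smooth_lieV|exact Hw].
Qed.

Lemma smooth_Q : smooth_fun_S3 Q.
Proof.
  apply smooth_fun_S3_lie_W0bar, smooth_fun_S3_lie_W0bar.
  exact (smooth_hamiltonian V u V_field u_ham).
Qed.

Lemma lieV_mult (f h : C2 -> C) (w : C2) :
  smooth_fun_S3 f -> smooth_fun_S3 h -> S3 w ->
  lieV (fun x => f x * h x)%C w = (lieV f w * h w + f w * lieV h w)%C.
Proof. apply act_mult. Qed.

Lemma lieV_conj (f : C2 -> C) (w : C2) :
  smooth_fun_S3 f -> S3 w -> lieV (fun x => Cconj (f x)) w = Cconj (lieV f w).
Proof.
  intros Hf Hw. pose proof (S3_nonzero w Hw) as Hn. unfold lieV.
  rewrite !act_realvec; [apply dirDC_conj|exact Hf|exact Hn| |exact Hn].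
  now apply smooth_fun_S3_conj.
Qed.

(* [u_nu] holds on an open set, so it can be differentiated along the flow. *)
Lemma Im_lieV_nuQ (w : C2) : S3 w -> nu w <> RtoC 0 ->
  Im (Cconj (lieV nu w) * Q w + Cconj (nu w) * lieV Q w)%C = 0.
Proof.
  intros Hw Hnu. pose proof smooth_Q as SQ.
  pose proof (smooth_fun_S3_conj _ nu_smooth) as Sc.
  rewrite <- (lieV_conj nu w nu_smooth Hw), <- (lieV_mult _ Q w Sc SQ Hw).
  set (h := fun x => (Cconj (nu x) * Q x)%C).
  assert (Sh : smooth_fun_S3 h) by now apply smooth_fun_S3_mult.
  destruct (is_deriveC_flow h 0 w Sh Hw) as [_ Hd].
  rewrite (cf_id _ _ g_flow w Hw) in Hd.
  (* By [flow_order1], nu changes by at most K |s| along the orbit; the radius keeps this below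
     |nu(w)|. *)
  assert (Hloc : locally 0 (fun s : R => nu (g s w) <> RtoC 0)).
  { destruct (flow_order1 nu w nu_smooth Hw) as (K & d & Hd0 & HK).
    apply Cmod_gt_0 in Hnu.
    pose proof (Rabs_pos K) as HKp.
    assert (Hr : 0 < Rmin d (Cmod (nu w) / (2 * (Rabs K + 1)))).
    { apply Rmin_pos; [exact Hd0|]. apply Rdiv_lt_0_compat; lra. }
    exists (mkposreal _ Hr). intros s Hs H0.
    assert (Hs' : Rabs s < Rmin d (Cmod (nu w) / (2 * (Rabs K + 1)))).
    { unfold ball in Hs; simpl in Hs.
      unfold AbsRing_ball, abs, minus, plus, opp in Hs; simpl in Hs.
      now rewrite Ropp_0, Rplus_0_r in Hs. }
    specialize (HK s (Rlt_le_trans _ _ _ Hs' (Rmin_l _ _))).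
    rewrite H0, pow_1 in HK.
    replace (RtoC 0 - nu w)%C with (- nu w)%C in HK by ring. rewrite Cmod_opp in HK.
    pose proof (Rlt_le_trans _ _ _ Hs' (Rmin_r _ _)) as Hs2.
    assert (K * Rabs s <= Rabs K * Rabs s)
      by (apply Rmult_le_compat_r; [apply Rabs_pos|apply Rle_abs]).
    assert (Hb : Rabs s * (2 * (Rabs K + 1)) < Cmod (nu w)).
    { apply Rmult_lt_reg_r with (/ (2 * (Rabs K + 1))).
      - apply Rinv_0_lt_compat. lra.
      - rewrite Rmult_assoc, Rinv_r, Rmult_1_r by lra. exact Hs2. }
    pose proof (Rabs_pos s). nra. }
  pose proof (is_derive_unique _ _ _ Hd) as E. rewrite <- E.
  rewrite (Derive_ext_loc _ (fun _ => 0)); [apply Derive_const|].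
  apply filter_imp with (2 := Hloc). intros s Hs.
  apply u_nu; [now apply (flow_S3 V g g_flow)|exact Hs].
Qed.

Lemma lie_W0_hamiltonian (w : C2) : nonzero w -> lie W0 uC w = Cconj (lie W0bar uC w).
Proof.
  intros Hw. rewrite <- lie_W0_conj. apply act_ext; [|exact Hw].
  intros x _. apply C_ext; simpl; ring.
Qed.

(** Since u is real, this makes the Laplacian of u twice the real part of Z Zbar u, the quantity
    contained in [alpha]. *)
Lemma lie_W0bar_W0_hamiltonian (w : C2) : nonzero w ->
  lie W0bar (lie W0 uC) w = Cconj (lie W0 (lie W0bar uC) w).
Proof.
  intros Hw. rewrite <- lie_W0bar_conj. apply act_ext; [|exact Hw].
  intros x Hx. now apply lie_W0_hamiltonian, S3_nonzero.
Qed.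

Lemma lieV_beta (w : C2) : S3 w -> lieV (beta u) w = (Ci * lieV Q w)%C.
Proof. intros Hw. exact (act_scal_fun _ Ci Q w smooth_Q Hw). Qed.

Lemma lieV_nu (w : C2) : S3 w ->
  lieV nu w = (uC w * (4 * Ci * nu w) + Ci * lie W0bar uC w * lie W0 nu w
    - Ci * lie W0 uC w * lie W0bar nu w)%C.
Proof.
  intros Hw. unfold lieV. rewrite (act_V V g u V_field g_flow u_ham nu w Hw).
  rewrite S1_invariant_infinitesimal by assumption. fold uC.
  rewrite lie_W0_hamiltonian by now apply S3_nonzero.
  rewrite Cmult_conj, Cconj_Ci. change (RtoC (u w)) with (uC w). ring.
Qed.

Lemma first_order_beta (w : C2) : S3 w -> nu w <> RtoC 0 ->
  Re (Cconj (nu w) * beta u w)%C = 0.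
Proof.
  intros Hw Hnu. pose proof (u_nu w Hw Hnu) as H. unfold beta. fold uC. fold Q.
  destruct (nu w), (Q w). simpl in *. lra.
Qed.

(** The third derivatives of u enter only through Im (nubar V Q). With p = nubar Q real, the
    differentiated hypothesis turns this into p Im (V nu / nu), which contains only first
    derivatives of u and nu, and u itself. *)
Lemma second_order_coefficient (w : C2) : S3 w -> nu w <> RtoC 0 ->
  RtoC (Re (Cconj (nu w) *
    (lieV (beta u) w + beta u w * (alpha u w + 3 * Cconj (alpha u w))))%C) =
  (Cconj (nu w) * Q w * (Laplacian uC w
     + RtoC (Re (/ nu w * lie W0bar nu w * lie W0 uC w
                 - / nu w * lie W0 nu w * lie W0bar uC w))))%C.
Proof.
  intros Hw Hnu. pose proof (S3_nonzero w Hw) as Hn.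
  pose proof (u_nu w Hw Hnu) as HP. pose proof (Im_lieV_nuQ w Hw Hnu) as HV.
  rewrite lieV_beta by exact Hw. rewrite (lieV_nu w Hw) in HV.
  unfold Laplacian, beta, alpha. fold uC. fold Q.
  rewrite lie_W0bar_W0_hamiltonian by exact Hn.
  rewrite lie_W0_hamiltonian in HV |- * by exact Hn.
  set (n := nu w) in *. set (q := Q w) in *. set (vq := lieV Q w) in *.
  set (x := lie W0bar uC w) in *. set (y := lie W0 (lie W0bar uC) w) in *.
  set (nb := lie W0bar nu w) in *. set (nz := lie W0 nu w) in *.
  unfold uC in *. set (r := u w) in *.
  set (p := Re (Cconj n * q)%C).
  assert (Hp : (Cconj n * q)%C = RtoC p) by (apply C_ext; [reflexivity|exact HP]).
  assert (Hninv : (n * / n)%C = RtoC 1) by now apply Cinv_r.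
  (* Solving for Q with the real factor p lets conj(V nu) Q be rewritten as p conj(V nu / nu). *)
  assert (Hq : q = (RtoC p * Cconj (/ n))%C).
  { rewrite <- Hp. transitivity (q * Cconj (n * / n))%C; [|rewrite Cmult_conj; ring].
    rewrite Hninv. destruct q. apply C_ext; simpl; ring. }
  rewrite Hp.
  (* The right-hand side is p Im (V nu / nu); the 4 r comes from the circle weight of nu. *)
  assert (HvQ : Im (Cconj n * vq)%C = p * (4 * r + Re (/ n * nz * x - / n * nb * Cconj x)%C)).
  { transitivity (Im (RtoC p * Cconj (0 - (RtoC r * (4 * Ci * n * / n)
       + Ci * x * nz * / n - Ci * Cconj x * nb * / n)))%C).
    - match type of HV with Im (Cconj ?l * q + _)%C = 0 =>
        replace (Cconj l * q)%C with (RtoC p * Cconj (l * / n))%C in HV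
          by (rewrite Hq, Cmult_conj; ring);
        transitivity (Im (RtoC p * Cconj (0 - l * / n))%C) end.
      + match type of HV with Im (RtoC p * Cconj ?l + _)%C = 0 =>
          transitivity (- Im (RtoC p * Cconj l)%C) end.
        * rewrite Im_plus in HV. lra.
        * destruct (_ * / n)%C. simpl. ring.
      + do 3 f_equal. ring.
    - replace (4 * Ci * n * / n)%C with (4 * Ci)%C
        by (transitivity (4 * Ci * (n * / n))%C; [rewrite Hninv; ring|ring]).
      destruct (/ n)%C, x, nz, nb. simpl. ring. }
  replace (Cconj n * (Ci * vq + Ci * q * (2 * Ci * RtoC r + Ci * y
      + 3 * Cconj (2 * Ci * RtoC r + Ci * y))))%C
    with (Ci * (Cconj n * vq) + Ci * (RtoC p) * (2 * Ci * RtoC r + Ci * y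
      + 3 * Cconj (2 * Ci * RtoC r + Ci * y)))%C by (rewrite <- Hp; ring).
  replace (Re (Ci * (Cconj n * vq) + Ci * (RtoC p) * (2 * Ci * RtoC r + Ci * y
      + 3 * Cconj (2 * Ci * RtoC r + Ci * y)))%C) with
    (- Im (Cconj n * vq)%C + p * (4 * r + 2 * Re y)).
  (* Here the 4 r of [HvQ] cancels the 4 r produced by alpha + 3 conj(alpha). *)
  - rewrite HvQ. destruct y, (/ n)%C, x, nz, nb. apply C_ext; simpl; ring.
  - destruct y, (Cconj n * vq)%C. simpl. ring.
Qed.

End SecondOrder.

Theorem proposition5p3
  (nu : C2 -> C) (V : C2 -> C2) (u : C2 -> R) (g : R -> C2 -> C2)
  (mu : R -> C2 -> C)
  (nu_smooth : smooth_fun_S3 nu)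
  (nu_lt1 : forall w, S3 w -> Cmod (nu w) < 1)
  (nu_inv : S1_invariant nu)
  (V_field : smooth_vector_field V)
  (g_flow : contact_flow V g)
  (u_ham : contact_hamiltonian V u)
  (u_nu : let uC := fun w => RtoC (u w) in
     forall w, S3 w -> nu w <> RtoC 0 ->
       Im (Cconj (nu w) * lie W0bar (lie W0bar uC) w)%C = 0)
  (mu_beltrami : forall s, is_beltrami nu (g s) (mu s)) :
  let uC := fun w => RtoC (u w) in
  let W0bar2u := lie W0bar (lie W0bar uC) in
  forall w, S3 w -> nu w <> RtoC 0 ->
  exists K delta : R, 0 < delta /\
  forall s : R, Rabs s < delta ->
    Cmod (RtoC (Cmod (mu s w))
      - (RtoC (Cmod (nu w))
         + RtoC ((1 - Cmod (nu w) ^ 2) / (2 * Cmod (nu w)))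
           * (RtoC ((1 + Cmod (nu w) ^ 2) * Cmod (W0bar2u w) ^ 2)
              - (Cconj (nu w) * W0bar2u w)
                * (Laplacian uC w
                   + RtoC (Re (/ nu w * lie W0bar nu w * lie W0 uC w
                               - / nu w * lie W0 nu w * lie W0bar uC w))))
           * RtoC (s ^ 2)))%C
    <= K * Rabs s ^ 3.
Proof.
  intros uC W0bar2u w Hw Hnu.
  pose proof (smooth_alpha V u V_field u_ham) as Sa.
  pose proof (smooth_beta V u V_field u_ham) as Sb.
  destruct (coef_0 V g g_flow w Hw) as [A0 B0].
  pose proof (modulus_expansion (fun s => alpha u (g s w)) (fun s => beta u (g s w))
    (coefA g w) (coefB g w) (alpha u w) (beta u w) (lieV V (beta u) w)
    (fun s => proj1 (is_deriveC_coef V g u V_field g_flow u_ham w s Hw))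
    (fun s => proj2 (is_deriveC_coef V g u V_field g_flow u_ham w s Hw))
    A0 B0 (flow_order1 V g V_field g_flow (alpha u) w Sa Hw)
    (flow_order2 V g V_field g_flow (beta u) w Sb Hw)
    (nu w) (fun s => mu s w) Hnu
    (fun s => beltrami_coef g nu (mu s) s w (mu_beltrami s) Hw)
    (first_order_beta nu u u_nu w Hw Hnu)) as H.
  (* The goal is [bigO 3] unfolded, at the fixed point [w]. *)
  apply (bigO_ext 3) with (2 := H). intros s.
  unfold W0bar2u, uC.
  (* The complex product in the statement becomes the image of a real number, so the remaining
     comparison is between real expressions. *)
  rewrite <- (second_order_coefficient nu V g u nu_smooth nu_inv V_field g_flow u_ham u_nu w Hw Hnu).
  replace (Cmod (beta u w)) with (Cmod (lie W0bar (lie W0bar (fun w => RtoC (u w))) w)).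
  - generalize (Re (Cconj (nu w) * (lieV V (beta u) w
      + beta u w * (alpha u w + 3 * Cconj (alpha u w))))%C) as x.
    generalize (Cmod (lie W0bar (lie W0bar (fun w => RtoC (u w))) w)) as y.
    generalize (Cmod (nu w)) as n. generalize (Cmod (mu s w)) as m.
    intros m n y x. apply C_ext; simpl; ring.
  - unfold beta. rewrite Cmod_mult.
    replace (Cmod Ci) with 1; [ring|].
    unfold Cmod; simpl. rewrite <- sqrt_1 at 1. f_equal. ring.
Qed.
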